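(* The frame of a $3\times3\times3$ cube can always be completed given any collection of $24$ colored cubes (arbitrary varieties, repetitions allowed). Consequently $\mathrm{fr}(3)=24$.
   Context: Fix a palette of six colors. A colored cube is a unit cube each of whose six faces is painted with a single color, every one of the six colors appearing on some face. Two colored cubes are of the same variety if one can be rigidly rotated onto the other with colors matching; there are exactly $30$ varieties. The frame of an $n\times n\times n$ cube consists of the $12n-16$ unit positions lying on its edges (corners included); building (completing) a frame means placing colored cubes into all these positions so that, on each of the six outer faces of the big cube, all visible unit faces have one common color. $\mathrm{fr}(n)$ denotes the smallest number $N$ such that from any collection of $N$ colored cubes (of arbitrary varieties, with repetition) one can select cubes to build an $n\times n\times n$ frame. *)

(* Defs.v *)
From HB Require Import structures.
From mathcomp Require Import all_boot all_order all_algebra all_fingroup.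

Set Implicit Arguments.
Unset Strict Implicit.
Unset Printing Implicit Defensive.

Import GRing.Theory.

Local Open Scope ring_scope.

Definition color : finType := 'I_6.

(** The face [(a, b)] of an axis-parallel cube is the one orthogonal to the axis
    [a], on the side of large coordinates if [b = true] and of small coordinates
    if [b = false]. *)
Definition face : finType := ('I_3 * bool)%type.

Definition colored_cube : finType :=
  {p : {ffun face -> color} | [forall c, [exists f, p f == c]]}.

Definition paint (q : colored_cube) : face -> color := val q.

(** The isometries of a centred cube are the signed permutations of the axes:
    [(s, e)] maps the basis vector of axis [a] to the one of axis [s a],
    reversed when [e a = true]. The rotations are those of determinant 1. *)
Definition isometry_mx (r : 'S_3 * {ffun 'I_3 -> bool}) : 'M[int]_3 :=
  diag_mx (\row_a (-1) ^+ r.2 a) *m perm_mx r.1.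

Definition rotation : finType :=
  {r : 'S_3 * {ffun 'I_3 -> bool} | \det (isometry_mx r) == 1}.

Definition rotate (r : rotation) (f : face) : face :=
  ((val r).1 f.1, f.2 (+) (val r).2 f.1).

Definition position (n : nat) : finType := {ffun 'I_3 -> 'I_n}.

Definition on_face (n : nat) (x : position n) (f : face) : bool :=
  x f.1 == (if f.2 then n.-1 else 0)%N :> nat.

(** An edge of the big cube is the intersection of two non-parallel faces. *)
Definition frame (n : nat) : {set position n} :=
  [set x | [exists f : face, exists g : face,
              [&& f.1 != g.1, on_face x f & on_face x g]]].

(** Collections are indexed families, so that repetitions are allowed. The unit
    cube chosen for the position [x] is number [sel x], turned by [rot x]; its
    face [g] then points in the direction [rotate (rot x) g]. The six outer faces
    of the big cube carry six different colors, as on a unit cube, so their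
    colors form a [colored_cube]; without this requirement opposite outer faces
    could share a color. *)
Definition frame_buildable (N n : nat) (c : 'I_N -> colored_cube) : Prop :=
  exists (big : colored_cube) (sel : position n -> 'I_N)
         (rot : position n -> rotation),
    {in frame n &, injective sel} /\
    forall (x : position n) (g : face), x \in frame n ->
      on_face x (rotate (rot x) g) ->
      paint (c (sel x)) g = paint big (rotate (rot x) g).

Definition frame_always_buildable (n N : nat) : Prop :=
  forall c : 'I_N -> colored_cube, frame_buildable n c.

Definition is_fr (n N : nat) : Prop :=
  frame_always_buildable n N /\
  forall M : nat, frame_always_buildable n M -> (N <= M)%N.

(* Main.v *)
From mathcomp Require Import all_boot all_algebra all_fingroup zify.
Require Import Defs.

Set Implicit Arguments.
Unset Strict Implicit.
Unset Printing Implicit Defensive.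

(** A cube of variety [V] other than the variety [T] of the big cube shares
    either no corner or exactly two corners with [T]. So the cubes at hand form a
    multigraph on the eight corners of [T], and by Hall's theorem the corners can
    be filled iff the number of tree components is at most the number of cubes
    of variety [T]. A variety with at least two cubes is called heavy: it kills
    all tree components that it touches. Up to permutations of the colors there
    are only 143 heavy sets that do not by themselves make some coloring
    fillable, and for each of them a bounded search over the varieties with one
    cube shows that at most 23 cubes can leave every coloring unfillable. A cube
    fits on an edge unless the two colors of the edge are opposite on it, so with
    24 cubes edges can obstruct only if at least 16 cubes share a pair of
    opposite colors or at least 14 share two such pairs, and then a big cube of
    one of these varieties works. Conversely, take five varieties that pairwise
    share no corner, with multiplicities 7, 7, 7, 1, 1: these 23 cubes leave
    every coloring unfillable. *)

(** * Colorings and varieties *)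

(* A coloring lists the colors of the faces; the face orthogonal to the axis [a]
   on the side [b] has index [2 * a + b]. *)
Definition colorings : seq (seq nat) :=
  Eval vm_compute in permutations (iota 0 6).

(* The three faces of each corner are listed in the cyclic order given by the
   orientation of space, which rotations preserve. *)
Definition corner_faces : seq (seq nat) :=
  [:: [:: 0; 2; 4]; [:: 0; 5; 2]; [:: 0; 4; 3]; [:: 0; 3; 5];
      [:: 1; 4; 2]; [:: 1; 2; 5]; [:: 1; 3; 4]; [:: 1; 5; 3]].

Definition canon3 (t : seq nat) : seq nat :=
  if t is [:: a; b; c] then
    if (a < b) && (a < c) then [:: a; b; c]
    else if (b < a) && (b < c) then [:: b; c; a] else [:: c; a; b]
  else t.

Definition corner_triples (p : seq nat) : seq (seq nat) :=
  [seq canon3 [seq nth 0 p f | f <- fs] | fs <- corner_faces].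

(* Each rotation class contains exactly one coloring with color 0 on face 0 and
   the least color not on faces 0 and 1 on face 2. *)
Definition varieties : seq (seq nat) :=
  Eval vm_compute in
  [seq p <- colorings | (nth 0 p 0 == 0) &&
                        (nth 0 p 2 == if nth 0 p 1 == 1 then 2 else 1)].

Definition variety_corners : seq (seq (seq nat)) :=
  Eval vm_compute in map corner_triples varieties.

(** The row is the variety that is placed and the column the variety of the big cube. Corners are
    numbered as on the column variety, so the table is not symmetric. *)
Definition shared_rows : seq (seq (seq nat)) :=
  Eval vm_compute in
  [seq [seq [seq k <- iota 0 8 | nth [::] ct k \in cv] | ct <- variety_corners]
     | cv <- variety_corners].

(** * Search for unfillable collections *)

Definition touches (a b : nat) (K : seq nat) : bool := (a \in K) || (b \in K).

(* [ks] lists the tree components of a graph on the eight corners; a corner in no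
   listed component lies in a component that contains a cycle. Distinct
   components are disjoint, so the last branch of the match is never taken. *)
Definition add_edge (e : seq nat) (ks : seq (seq nat)) : seq (seq nat) :=
  if e is [:: a; b] then
    let rest := [seq K <- ks | ~~ touches a b K] in
    match [seq K <- ks | touches a b K] with
    | [::] | [:: _] => rest
    | [:: K1; K2] => (K1 ++ K2) :: rest
    | _ => ks
    end
  else ks.

(* The entry number [T] holds the number of cubes of variety [T] placed so far and
   the tree components of the graph on the corners of [T]. *)
Definition state : Type := seq (nat * seq (seq nat)).
Definition state0 : state := nseq 30 (0, [seq [:: k] | k <- iota 0 8]).

Fixpoint put (row : seq (seq nat)) (st : state) : state :=
  match row, st with
  | e :: row', x :: st' => (x.1, add_edge e x.2) :: put row' st'
  | _, _ => [::]
  end.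

Fixpoint mark (v : nat) (st : state) : state :=
  match v, st with
  | _, [::] => [::]
  | 0, x :: st' => (x.1.+1, x.2) :: st'
  | v'.+1, x :: st' => x :: mark v' st'
  end.

Definition place (v : nat) (st : state) : state :=
  mark v (put (nth [::] shared_rows v) st).

Definition dead (st : state) : bool := has (fun x => size x.2 <= x.1) st.

Definition slots (st : state) (v : nat) : nat := size (nth (0, [::]) st v).2.

(* [inner k] bounds the number of varieties that share two corners with a given
   one, both of them among [k] prescribed corners. *)
Definition inner (k : nat) : nat := nth 0 [:: 0; 0; 2; 3; 6; 8; 12; 15; 20] k.

(* A variety of an unfillable collection with [n] varieties has at most
   [cap_of n] cubes, because at most 9 varieties share no corner with it. *)
Definition cap_of (n : nat) : nat :=
  foldr maxn 0 [seq c.-1 - (n - 10 - inner (8 - c)) | c <- iota 1 8].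

Definition caps : seq nat := Eval vm_compute in map cap_of (iota 0 31).

(* [H] are the heavy varieties, [l] the number of light ones placed so far, and the
   remaining light ones are in [free]. *)
Definition small (st : state) (H : seq nat) (l : nat) (free : seq nat) : bool :=
  let h := size H in
  let f := count (fun v => 1 < slots st v) free in
  all (fun n => let M := nth 0 caps n in
         (M == 0) || (sumn [seq minn (slots st v).-1 M | v <- H] + (n - h) < 24))
      (iota (h + l) f.+1).

(* Nested conditionals, since [vm_compute] evaluates both sides of [||]. *)
Fixpoint no_light (H : seq nat) (st : state) (l : nat) (free : seq nat) : bool :=
  if dead st then true else if small st H l free then true else
  if free is v :: free' then
    (if 1 < slots st v then no_light H (place v st) l.+1 free' else true)
    && no_light H st l free'
  else false.

Definition recolor (s p : seq nat) : seq nat := [seq nth 0 s c | c <- p].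

Definition variety_of (p : seq nat) : nat :=
  let ct := corner_triples p in
  find (fun cv : seq (seq nat) => all [in cv] ct) variety_corners.

Definition actions : seq (seq nat * seq nat) :=
  Eval vm_compute in
  [seq (s, [seq variety_of (recolor s p) | p <- varieties]) | s <- colorings].

(** Two cubes of a variety form a double edge, hence a cycle, so placing more than two of them would
    not change the tree components any further. *)
Definition heavy_state (H : seq nat) : state :=
  foldr (fun v st => place v (place v st)) state0 H.

Definition moves_into (level : seq (seq nat)) (H : seq nat)
    (sa : seq nat * seq nat) : bool :=
  sort leq [seq nth 0 sa.2 v | v <- H] \in level.

Definition next_level (level : seq (seq nat)) : seq (seq nat) :=
  let extensions H :=
    let st := heavy_state H in
    [seq v :: H | v <- iota 0 30
                & (v \notin H) && ~~ dead (place v (place v st))] in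
  foldl (fun reps H =>
           if has (moves_into reps H) actions then reps else sort leq H :: reps)
        [::] (flatten (map extensions level)).

(* [nth [::] levels j] represents the heavy sets of size [j] up to permutations of
   the colors. *)
Definition levels : seq (seq (seq nat)) :=
  Eval vm_compute in traject next_level [:: [::]] 7.

Definition witness (H : seq nat) : seq nat * seq nat :=
  let i := find (moves_into (nth [::] levels (size H)) H) actions in
  let sa := nth ([::], [::]) actions i in
  (sa.1, [seq nth 0 sa.2 v | v <- H]).

(* For each representative [R] and each variety [v] that can be added to it, a
   permutation of the colors and the images under it of the members of [v :: R],
   which form again a representative. *)
Definition certificate : seq (seq (seq nat * seq (seq nat * seq nat))) :=
  Eval vm_compute in
  [seq [seq (R, let st := heavy_state R in
              [seq if (v \in R) || dead (place v (place v st)) then ([::], [::])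
                   else witness (v :: R) | v <- iota 0 30]) | R <- level]
     | level <- levels].

(** The images are verified from the corner triples, which determine a variety. The soundness of the
    certificate thus rests on this check and not on the search that found it. *)
Definition check_witness (H : seq nat) (w : seq nat * seq nat) : bool :=
  [&& perm_eq w.1 (iota 0 6), size w.2 == size H,
      all (fun VW => all [in nth [::] variety_corners VW.2]
              (corner_triples (recolor w.1 (nth [::] varieties VW.1)))) (zip H w.2)
    & has (fun R : seq nat => all [in R] w.2) (nth [::] levels (size H))].

Definition check_class (c : seq nat * seq (seq nat * seq nat)) : bool :=
  let: (R, ws) := c in
  let st := heavy_state R in
  [&& uniq R, all (gtn 30) R,
      no_light R st 0 [seq v <- iota 0 30 | v \notin R]
    & all (fun v => [|| v \in R, dead (place v (place v st))
                      | check_witness (v :: R) (nth ([::], [::]) ws v)])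
          (iota 0 30)].

(** * Unfillable collections have at most 23 cubes *)

Definition variety (V : nat) : seq nat := nth [::] varieties V.
Definition shared (V T : nat) : seq nat := nth [::] (nth [::] shared_rows V) T.

Definition hits (p q C : seq nat) : bool :=
  has (fun k => nth [::] (corner_triples q) k \in corner_triples p) C.

Definition corner_set (C : seq nat) : bool := uniq C && all (gtn 8) C.

(* [m V] is the number of cubes of variety [V]; [C] violates Hall's condition. *)
Definition unfillable (m : nat -> nat) (q : seq nat) : Prop :=
  exists2 C, corner_set C & \sum_(0 <= V < 30 | hits (variety V) q C) m V < size C.

Definition stuck (m : nat -> nat) : Prop :=
  forall q, q \in colorings -> unfillable m q.

Lemma all_iotaP (P : pred nat) n :
  reflect (forall k, k < n -> P k) (all P (iota 0 n)).
Proof.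
apply: (iffP allP) => [PP k lt_k | PP k]; last by rewrite mem_iota => /PP.
by apply: PP; rewrite mem_iota.
Qed.

Lemma variety_coloring V : V < 30 -> variety V \in colorings.
Proof.
move: V; apply/all_iotaP; vm_cast_no_check (erefl true).
Qed.

Lemma variety_cornersE V : nth [::] variety_corners V =
  if V < 30 then corner_triples (variety V) else [::].
Proof.
case: ltnP => [|le_V]; last by rewrite nth_default.
move=> lt_V; apply/eqP; move: V lt_V; apply/all_iotaP;
  vm_cast_no_check (erefl true).
Qed.

Lemma sharedE V T : V < 30 -> T < 30 ->
  shared V T = [seq k <- iota 0 8 | nth [::] (corner_triples (variety T)) k \in
    corner_triples (variety V)].
Proof.
have chk : all (fun V => all (fun T => shared V T ==
   [seq k <- iota 0 8 | nth [::] (nth [::] variety_corners T) k \in nth [::]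
     variety_corners V])
   (iota 0 30)) (iota 0 30) by vm_cast_no_check (erefl true).
move=> ltV ltT; move/all_iotaP: chk => /(_ V ltV)/all_iotaP/(_ T ltT)/eqP->.
by rewrite !variety_cornersE ltV ltT.
Qed.

Lemma hits_shared V T C : V < 30 -> T < 30 -> corner_set C ->
  hits (variety V) (variety T) C = has [in C] (shared V T).
Proof.
move=> ltV ltT /andP[_ /allP ltC]; rewrite sharedE //.
apply/hasP/hasP=> [[k Ck sk] | [k]].
  by exists k => //; rewrite mem_filter sk mem_iota; apply: (ltC _ Ck).
by rewrite mem_filter => /andP[sk _] Ck; exists k.
Qed.

Lemma shared_self T : T < 30 -> shared T T = iota 0 8.
Proof. move=> ltT; apply/eqP; move: T ltT; apply/all_iotaP;
  vm_cast_no_check (erefl true). Qed.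

(** * Soundness of the search state *)

Lemma count_sum_mem (P : pred nat) n (s : seq nat) : all (gtn n) s ->
  count P s = \sum_(0 <= V < n | P V) count_mem V s.
Proof.
elim: s => [|x s IH] /=; first by rewrite big1.
case/andP=> ltx /IH->; rewrite big_split /=; congr (_ + _).
rewrite big_mkcond (bigD1_seq x) ?mem_index_iota ?iota_uniq //= eqxx.
by rewrite big1 ?addn0 => [|V /negPf];
  [case: (P x) | rewrite eq_sym => ->; case: (P V)].
Qed.

(** An edge that avoids [C] touches no component inside [C]. Any other edge costs at most one
    component inside [C]: two merged components lie in [C] only if both do, and otherwise at most
    one of them was inside. *)
Lemma add_edge_count (C e : seq nat) ks :
  count (fun K : seq nat => all [in C] K) ks
    <= count (fun K : seq nat => all [in C] K) (add_edge e ks) + has [in C] e.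
Proof.
case: e => [|a [|b [|c e]]]; try exact: leq_addr.
set P := fun K => _; rewrite /add_edge [has _ _]/= orbF.
set touch := touches a b.
have splitP : count P ks =
  count P [seq K <- ks | touch K] + count P [seq K <- ks | ~~ touch K].
  by elim: ks => //= K ks ->; case: (touch K) => /=; lia.
have [hit | /norP[aC bC]] := boolP (_ || _); last first.
  have : count P [seq K <- ks | touch K] = 0.
    apply/eqP; rewrite -leqn0 leqNgt -has_count; apply/hasPn => K.
    rewrite mem_filter => /andP[/orP tK _]; apply/negP => /allP KC.
    by case: tK => /KC /= HK; [rewrite HK in aC | rewrite HK in bC].
  move=> z; rewrite z in splitP; case: [seq K <- ks | touch K] z =>
    [|K1 [|K2 [|]]] //=; lia.
case: [seq K <- ks | touch K] splitP => [|K1 [|K2 [|]]] //=; rewrite ?/P ?all_cat;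
  lia.
Qed.

(* Only the tree components contained in [C] contribute to the deficiency of [C]. *)
Definition tree_bound (T : nat) (Vs : seq nat) (ks : seq (seq nat)) : Prop :=
  forall C, corner_set C ->
  size C <= count (fun K : seq nat => all [in C] K) ks
            + count (fun V => (V != T) && has [in C] (shared V T)) Vs.

(** The list [Vs] holds the cubes placed so far with repetition. It is only a part of the collection
    [m], so what the state says about it remains a valid bound while further cubes are placed. *)
Record tracks (m : nat -> nat) (Vs : seq nat) (st : state) : Prop := Tracks {
  tracks_size : size st = 30;
  tracks_lt : all (gtn 30) Vs;
  tracks_count : forall V, count_mem V Vs <= m V;
  tracks_mark : forall T, T < 30 -> (nth (0, [::]) st T).1 = count_mem T Vs;
  tracks_trees : forall T, T < 30 -> tree_bound T Vs (nth (0, [::]) st T).2 }.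

Lemma nth_put row st T : T < size row -> T < size st ->
  nth (0, [::]) (put row st) T
    = ((nth (0, [::]) st T).1, add_edge (nth [::] row T) (nth (0, [::]) st T).2).
Proof. by elim: row st T => [|e row IH] [|x st] [|T] //=; rewrite !ltnS; apply:
  IH. Qed.

Lemma size_put row st : size (put row st) = minn (size row) (size st).
Proof. by elim: row st => [|e row IH] [|x st] //=; rewrite IH minnSS. Qed.

Lemma size_mark v st : size (mark v st) = size st.
Proof. by elim: st v => [|x st IH] [|v] //=; rewrite IH. Qed.

Lemma nth_mark v st T : T < size st ->
  nth (0, [::]) (mark v st) T
    = ((nth (0, [::]) st T).1 + (T == v), (nth (0, [::]) st T).2).
Proof.
elim: st v T => [|x st IH] [|v] [|T] //= ltT; rewrite ?addn0 ?addn1 //;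
  last by rewrite IH.
  by case: (nth _ _ _).
by case: x.
Qed.

Lemma size_shared_row V : V < 30 -> size (nth [::] shared_rows V) = 30.
Proof. move=> ltV; apply/eqP; move: V ltV; apply/all_iotaP;
  vm_cast_no_check (erefl true). Qed.

Lemma count_singletons C : corner_set C ->
  count (fun k => all [in C] [:: k]) (iota 0 8) = size C.
Proof.
case/andP=> uC /allP ltC; rewrite -size_filter; apply/perm_size/uniq_perm => //.
  by rewrite filter_uniq ?iota_uniq.
move=> k; rewrite mem_filter mem_iota /= andbT.
by case: (boolP (k \in C)) => //= /ltC.
Qed.

Lemma tracks0 m : tracks m [::] state0.
Proof.
split=> // T ltT; first by rewrite nth_nseq ltT.
move=> C sC; rewrite nth_nseq ltT /= addn0.
by rewrite -(count_singletons sC).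
Qed.

Lemma tracks_place m Vs st v : v < 30 -> count_mem v Vs < m v ->
  tracks m Vs st -> tracks m (v :: Vs) (place v st).
Proof.
move=> ltv mv [sz ltVs cnt mk tr].
have szp : size (put (nth [::] shared_rows v) st) = 30.
  by rewrite size_put size_shared_row // sz.
split.
- by rewrite size_mark.
- by rewrite /= ltv.
- by move=> V /=; case: eqP => [<-|_] //; rewrite add0n.
- move=> T ltT; rewrite nth_mark ?szp // nth_put ?size_shared_row ?sz //= mk //.
  by rewrite addnC eq_sym.
move=> T ltT C sC; rewrite nth_mark ?szp // nth_put ?size_shared_row ?sz //=.
have := tr T ltT C sC.
(* For [v = T] the row entry lists all eight corners. It is not a pair, so [add_edge] leaves the
   components alone, and [tree_bound] does not count this cube either. *)
have [->|neq_vT] := eqVneq v T.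
  by rewrite [nth [::] (nth _ _ _) _](shared_self ltT).
have := add_edge_count C (shared v T) (nth (0, [::]) st T).2; rewrite /= /shared;
  lia.
Qed.

Lemma sum_hits m T C : T < 30 -> corner_set C ->
  \sum_(0 <= V < 30 | hits (variety V) (variety T) C) m V
    = \sum_(0 <= V < 30 | has [in C] (shared V T)) m V.
Proof.
move=> ltT sC; rewrite big_nat_cond [RHS]big_nat_cond; apply: eq_bigl => V.
by case: (ltnP V 30) => //= ltV; rewrite hits_shared.
Qed.

Lemma sum_hits_self m T C : T < 30 -> corner_set C -> 0 < size C ->
  \sum_(0 <= V < 30 | hits (variety V) (variety T) C) m V
    = m T + \sum_(0 <= V < 30 | (V != T) && has [in C] (shared V T)) m V.
Proof.
move=> ltT sC; rewrite sum_hits //; case: C sC => // k C sC _.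
rewrite big_mkcond (bigD1_seq T) ?mem_index_iota ?iota_uniq //= -big_mkcondr.
suff -> : has [in k :: C] (shared T T) by [].
rewrite shared_self //; apply/hasP; exists k; last by rewrite inE eqxx.
by rewrite mem_iota; case/andP: sC => _ /andP[].
Qed.

(** Take [C] violating Hall's condition for [T]. The cubes of [T] and the others that meet [C] are
    fewer than [size C], which by [tree_bound] is at most the number of tree components in [C] plus
    the placed cubes other than [T] that meet [C]. The latter cancel. *)
Lemma slots_gt m Vs st T : stuck m -> tracks m Vs st -> T < 30 -> m T < slots st T.
Proof.
move=> bad [sz ltVs cnt _ tr] ltT.
have [C sC] := bad _ (variety_coloring ltT).
case: (posnP (size C)) => [->//|C0]; rewrite sum_hits_self // => lt_sum.
have := tr T ltT C sC; rewrite (count_sum_mem _ ltVs) => le_C.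
have : \sum_(0 <= V < 30 | (V != T) && has [in C] (shared V T)) count_mem V Vs
    <= \sum_(0 <= V < 30 | (V != T) && has [in C] (shared V T)) m V.
  by apply: leq_sum => V _; apply: cnt.
have := count_size (fun K : seq nat => all [in C] K) (nth (0, [::]) st T).2.
rewrite /slots; lia.
Qed.

Lemma deadN m Vs st : stuck m -> tracks m Vs st -> ~~ dead st.
Proof.
move=> bad tr; apply/hasPn => x /(nthP (0, [::]))[T ltT <-].
have ltT30 : T < 30 by rewrite -(tracks_size tr).
rewrite -ltnNge (tracks_mark tr) //.
by apply: leq_ltn_trans (tracks_count tr T) (slots_gt bad tr ltT30).
Qed.

Fixpoint subseqs (T : Type) (s : seq T) : seq (seq T) :=
  if s is x :: s' then map (cons x) (subseqs s') ++ subseqs s' else [:: [::]].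

Lemma filter_subseqs (T : eqType) (P : pred T) s : filter P s \in subseqs s.
Proof.
elim: s => //= x s IH; rewrite mem_cat; case: (P x); last by rewrite IH orbT.
by rewrite map_f.
Qed.

Definition variety_count (m : nat -> nat) : nat :=
  count (fun V => 0 < m V) (iota 0 30).

(** Nine varieties share no corner with [T]. Any other variety that avoids [C] has its two shared
    corners among the [8 - size C] remaining ones. *)
Lemma outside_corners T C : T < 30 -> corner_set C -> 0 < size C ->
  count (fun V => ~~ has [in C] (shared V T)) (iota 0 30) <= 9 + inner (8 - size C).
Proof.
have chk : all (fun T => let col := [seq shared V T | V <- iota 0 30] in
    all (fun C => (C == [::]) || (count (fun e : seq nat => ~~ has [in C] e) col <=
      9 + inner (8 - size C)))
        (subseqs (iota 0 8))) (iota 0 30).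
  by vm_cast_no_check (erefl true).
move=> ltT /andP[uC /allP ltC] C0; move/all_iotaP: chk => /(_ T ltT)/allP.
(* The check ranges over increasing lists, so it is applied to the sorted copy of [C]. *)
move=> /(_ _ (filter_subseqs [in C] (iota 0 8))).
have eqC : [seq k <- iota 0 8 | k \in C] =i C.
  by move=> k; rewrite mem_filter mem_iota /=; case: (boolP (k \in C)) => //= /ltC.
have -> : size [seq k <- iota 0 8 | k \in C] = size C.
  by apply/perm_size/uniq_perm => //; rewrite filter_uniq ?iota_uniq.
case/orP=> [/eqP z|].
  by case: C eqC z C0 {uC ltC} => // k C /(_ k); rewrite mem_head => eqC z;
    rewrite z in eqC.
rewrite count_map; congr (_ <= _); apply: eq_count => V /=; congr (~~ _).
by apply: eq_has => k; rewrite /= eqC.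
Qed.

Lemma count_cover3 (A : Type) (P P1 P2 P3 : pred A) (s : seq A) :
  (forall x, P x -> [|| P1 x, P2 x | P3 x]) ->
  count P s <= count P1 s + count P2 s + count P3 s.
Proof.
move=> cover; elim: s => //= x s IH.
have : P x <= P1 x + P2 x + P3 x.
  by move: (cover x); case: (P x) => // /(_ isT); case: (P1 x); case: (P2 x); case:
    (P3 x).
move: (count P s) (count P1 s) (count P2 s) (count P3 s) IH => n n1 n2 n3; lia.
Qed.

(** Let [C] violate Hall's condition for [T]. Of the [n] varieties present, all but [T] and at most
    [9 + inner (8 - size C)] others meet [C]. They use up at least one cube each of the at most
    [size C - 1] cubes available, and [T] has at most the rest. *)
Lemma capP m T : stuck m -> T < 30 -> m T <= cap_of (variety_count m).
Proof.
move=> bad ltT; have [C sC] := bad _ (variety_coloring ltT).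
case: (posnP (size C)) => [->//|C0]; rewrite sum_hits_self // => lt_sum.
have out := outside_corners ltT sC C0.
have le8 : size C <= 8.
  rewrite -(size_iota 0 8) uniq_leq_size //; first by case/andP: sC.
  by move=> k kC; rewrite mem_iota; case/andP: sC => _ /allP/(_ _ kC).
have ge : variety_count m <=
  1 + count (fun V => (V != T) && has [in C] (shared V T) && (0 < m V)) (iota 0 30)
    + count (fun V => ~~ has [in C] (shared V T)) (iota 0 30).
  have one : count (pred1 T) (iota 0 30) = 1.
    by rewrite count_uniq_mem ?iota_uniq // mem_iota ltT.
  rewrite -[X in X + _ + _]one; apply: count_cover3 => V mV /=; rewrite mV andbT.
  by case: eqP => //= _; case: has.
have le_sum : count (fun V => (V != T) && has [in C] (shared V T) && (0 < m V))
  (iota 0 30)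
   <= \sum_(0 <= V < 30 | (V != T) && has [in C] (shared V T)) m V.
  rewrite -sum1_count big_mkcondr; apply: leq_sum => V _; by case: (m V).
have bnd : m T <= (size C).-1 - (variety_count m - 10 - inner (8 - size C)) by lia.
apply: leq_trans bnd _; rewrite /cap_of.
have : size C \in iota 1 8 by rewrite mem_iota C0 /= ltnS.
elim: (iota 1 8) => //= c s IH; rewrite inE => /orP[/eqP->|/IH];
  rewrite leq_max ?leqnn // => ->.
by rewrite orbT.
Qed.

Lemma variety_count_le m : variety_count m <= 30.
Proof. by rewrite -[leqRHS](size_iota 0) count_size. Qed.

Lemma nth_caps n : n <= 30 -> nth 0 caps n = cap_of n.
Proof.
move=> len; have -> : caps = map cap_of (iota 0 31)
  by vm_cast_no_check (erefl caps).
by rewrite (nth_map 0) ?size_iota // nth_iota.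
Qed.

Lemma sum_over_cover m (s : seq nat) : uniq s -> all (gtn 30) s ->
  (forall V, V < 30 -> 0 < m V -> V \in s) ->
  (variety_count m = count (fun V => 0 < m V) s)
  * (\sum_(0 <= V < 30) m V = \sum_(V <- s) m V).
Proof.
move=> us lts cov.
have eqs : perm_eq [seq V <- iota 0 30 | 0 < m V] [seq V <- s | 0 < m V].
  apply: uniq_perm; rewrite ?filter_uniq ?iota_uniq // => V;
    rewrite !mem_filter mem_iota /=.
  case: posnP => //= mV; apply/idP/idP => [ltV | /(allP lts)//]; exact: cov.
split; first by rewrite /variety_count -!size_filter (perm_size eqs).
have F (t : seq nat) : \sum_(V <- t) m V = \sum_(V <- [seq V <- t | 0 < m V]) m V.
  by rewrite big_filter [RHS]big_mkcond; apply: eq_bigr => V _; case: (m V).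
by rewrite F [RHS]F /index_iota subn0; apply: perm_big.
Qed.

(** By [slots_gt] a free variety can occur only if it has at least two slots, which confines the
    number [n] of varieties present to the range that [small] tests. For this [n] each heavy variety
    is bounded by its slots and by [cap_of n], and the other [n - h] varieties have one cube
    each. *)
Lemma small_sum m Vs st (H L free : seq nat) : stuck m -> tracks m Vs st ->
  uniq (H ++ L ++ free) -> all (gtn 30) (H ++ L ++ free) ->
  (forall V, V < 30 -> (V \in H) = (1 < m V)) ->
  (forall V, V \in L -> 0 < m V) ->
  (forall V, V < 30 -> 0 < m V -> V \in H ++ L ++ free) ->
  small st H (size L) free -> \sum_(0 <= V < 30) m V < 24.
Proof.
move=> bad tr us lts heavy light cov /allP sm.
have [supE ->] := sum_over_cover us lts cov.
have ltH V : V \in H -> V < 30 by move=> VH; apply: (allP lts); rewrite mem_cat VH.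
have ltF V : V \in free -> V < 30 by move=> VH; apply: (allP lts);
  rewrite !mem_cat VH !orbT.
have cH : count (fun V => 0 < m V) H = size H.
  by apply/eqP; rewrite -all_count; apply/allP => V VH /=; apply: ltnW;
    rewrite -heavy ?ltH.
have cL : count (fun V => 0 < m V) L = size L.
  by apply/eqP; rewrite -all_count; apply/allP => V /light.
have cF : count (fun V => 0 < m V) free <= count (fun v => 1 < slots st v) free.
  by rewrite -!size_filter; apply: uniq_leq_size; [
     rewrite filter_uniq //; move: us; rewrite !cat_uniq => /and3P[_ _ /and3P[]] |
     move=> V; rewrite !mem_filter => /andP[mV VF]; rewrite VF andbT;
     apply: leq_ltn_trans mV (slots_gt bad tr (ltF _ VF))].
rewrite !count_cat cH cL in supE.
have : variety_count m \in iota (size H + size L)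
  (count (fun v => 1 < slots st v) free).+1.
  by rewrite mem_iota; lia.
move/sm; rewrite nth_caps ?variety_count_le //; case/orP => [/eqP cap0 | lt24].
  rewrite big1_seq // => V /andP[_ /(allP lts) ltV].
  by apply/eqP; rewrite -leqn0 -cap0 capP.
apply: leq_ltn_trans lt24; rewrite !big_cat /= sumnE big_map; apply: leq_add.
  rewrite big_seq [leqRHS]big_seq; apply: leq_sum => V VH.
  rewrite leq_min capP ?ltH // andbT -ltnS (leq_trans (slots_gt bad tr (ltH _ VH)))
    //.
  by case: (slots st V).
have le1 (s : seq nat) : {subset s <= L ++ free} ->
  \sum_(V <- s) m V = count (fun V => 0 < m V) s.
  move=> sub; rewrite -sum1_count [RHS]big_mkcond big_seq [RHS]big_seq; apply:
    eq_bigr => V /sub VLF.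
  have ltV : V < 30 by apply: (allP lts); rewrite mem_cat VLF orbT.
  have : V \notin H.
    move: us; rewrite cat_uniq => /and3P[_ /hasPn/(_ _ VLF)//].
  by rewrite heavy // -leqNgt; case: (m V) => [|[]].
rewrite (le1 L) => [|V VL]; last by rewrite mem_cat VL.
rewrite (le1 free) => [|V VF]; last by rewrite mem_cat VF orbT.
by rewrite cL supE addKn.
Qed.

Lemma no_lightP m Vs st (H L free : seq nat) : stuck m -> tracks m Vs st ->
  (forall V, V \notin H ++ L -> V \notin Vs) ->
  uniq (H ++ L ++ free) -> all (gtn 30) (H ++ L ++ free) ->
  (forall V, V < 30 -> (V \in H) = (1 < m V)) ->
  (forall V, V \in L -> 0 < m V) ->
  (forall V, V < 30 -> 0 < m V -> V \in H ++ L ++ free) ->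
  no_light H st (size L) free -> \sum_(0 <= V < 30) m V < 24.
Proof.
move=> bad + + + + heavy.
elim: free Vs st L => [|v free IH] Vs st L tr new us lts light cov /=;
  rewrite (negPf (deadN bad tr)) /=.
  by case: ifP => // sm _; apply: (small_sum bad tr us lts heavy light cov).
case: ifP => [sm _ | _]; first exact: (small_sum bad tr us lts heavy light cov).
have ltv : v < 30 by apply: (allP lts); rewrite !mem_cat mem_head !orbT.
have us' : uniq (H ++ (v :: L) ++ free).
  rewrite (perm_uniq (_ : perm_eq _ (H ++ L ++ v :: free))) // perm_cat2l.
  by rewrite -cat_rcons perm_cat2r perm_sym perm_rcons.
have vHL : v \notin H ++ L.
  by move: us; rewrite catA cat_uniq => /and3P[_ /hasPn/(_ v)/(_ (mem_head _ _))].
have vNH : v \notin H by apply: contra vHL; rewrite mem_cat => ->.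
have mem' V : (V \in H ++ (v :: L) ++ free) = (V \in H ++ L ++ v :: free).
  by rewrite !mem_cat !inE; case: (V == v); rewrite /= ?orbT.
(* Either [v] does not occur and is dropped, or it has exactly one cube, because all varieties with
   more are in [H]. In the second case [slots_gt] guarantees two slots, so the search did explore
   this branch. *)
case/andP=> inb; case: (posnP (m v)) => [mv0 | mv _].
  apply: IH tr new _ _ light _.
  - by apply: subseq_uniq us; rewrite cat_subseq // cat_subseq // subseq_cons.
  - by apply/allP => V; rewrite !mem_cat => VV; apply: (allP lts);
      rewrite !mem_cat inE; case/or3P: VV => ->; rewrite ?orbT.
  move=> V ltV mV; move: (cov V ltV mV); rewrite !mem_cat inE.
  by case: (eqVneq V v) mV => [->|//]; rewrite mv0.
have mv1 : m v = 1 by move: vNH; rewrite heavy //; case: (m v) mv => [|[]].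
move: inb; rewrite (leq_trans _ (slots_gt bad tr ltv)) ?mv1 //.
apply: (IH (v :: Vs) _ (v :: L)) => //.
- apply: tracks_place tr => //; by rewrite mv1 (count_memPn _) // new.
- move=> V; rewrite mem_cat !inE orbCA !negb_or => /andP[-> VHL] /=.
  by apply: new; rewrite mem_cat negb_or.
- by apply/allP => V; rewrite mem' => /(allP lts).
- by move=> V; rewrite inE => /orP[/eqP->|/light].
- by move=> V ltV mV; rewrite mem' cov.
Qed.

(** * Permutations of the colors *)

Lemma mem_colorings p : (p \in colorings) = perm_eq p (iota 0 6).
Proof.
have -> : colorings = permutations (iota 0 6) by vm_cast_no_check (erefl colorings).
exact: mem_permutations.
Qed.

Lemma coloring_size p : p \in colorings -> size p = 6.
Proof. by rewrite mem_colorings => /perm_size. Qed.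

Lemma coloring_uniq p : p \in colorings -> uniq p.
Proof. by rewrite mem_colorings => /perm_uniq->; rewrite iota_uniq. Qed.

Lemma coloring_mem p c : p \in colorings -> (c \in p) = (c < 6).
Proof. by rewrite mem_colorings => /perm_mem->; rewrite mem_iota. Qed.

Lemma coloring_nth_lt p f : p \in colorings -> f < 6 -> nth 0 p f < 6.
Proof. by move=> cp ltf; rewrite -(coloring_mem _ cp) mem_nth // coloring_size. Qed.

Lemma recolor_coloring s p :
  s \in colorings -> p \in colorings -> recolor s p \in colorings.
Proof.
move=> cs cp; rewrite mem_colorings; have := cp; rewrite mem_colorings.
move/(perm_map (nth 0 s)) => /perm_trans; apply.
by rewrite -(coloring_size cs) map_nth_iota0 // take_size coloring_size //
  -mem_colorings.
Qed.

Definition inverse (s : seq nat) : seq nat := [seq index c s | c <- iota 0 6].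

Lemma nth_inverse s c : c < 6 -> nth 0 (inverse s) c = index c s.
Proof. by move=> ltc; rewrite (nth_map 0) ?size_iota // nth_iota. Qed.

Lemma inverse_coloring s : s \in colorings -> inverse s \in colorings.
Proof.
move=> cs; rewrite mem_colorings.
have us : uniq (inverse s).
  rewrite map_inj_in_uniq ?iota_uniq // => c d; rewrite !mem_iota !add0n /=.
  by rewrite -!(coloring_mem _ cs) => cs_c cs_d; apply: (index_inj 0).
have sub : {subset inverse s <= iota 0 6}.
  move=> i /mapP[c c_in ->]; move: c_in; rewrite !mem_iota !add0n /=
    -(coloring_mem _ cs) => sc.
  by rewrite -(coloring_size cs) index_mem.
apply: uniq_perm; rewrite ?iota_uniq //.
by have [] := uniq_min_size us sub; rewrite ?size_map.
Qed.

Lemma recolorK s p : s \in colorings -> p \in colorings ->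
  recolor (inverse s) (recolor s p) = p.
Proof.
move=> cs cp; rewrite /recolor -map_comp -[RHS]map_id; apply/eq_in_map => c pc /=.
have ltc : c < 6 by rewrite -(coloring_mem _ cp).
by rewrite nth_inverse ?coloring_nth_lt // index_uniq ?coloring_uniq ?coloring_size.
Qed.

Lemma canon3_rot a b c : uniq [:: a; b; c] ->
  canon3 [:: b; c; a] = canon3 [:: a; b; c].
Proof.
rewrite /= !inE negb_or andbT => /andP[/andP[ab ac] bc].
by case: (ltngtP a b) ab; case: (ltngtP a c) ac; case: (ltngtP b c) bc => //; lia.
Qed.

Lemma canon3_recolor s a b c : uniq [:: nth 0 s a; nth 0 s b; nth 0 s c] ->
  canon3 (recolor s (canon3 [:: a; b; c])) = canon3 (recolor s [:: a; b; c]).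
Proof.
move=> us; rewrite [canon3 [:: a; b; c]]/canon3; case: ifP => // _; case: ifP => _.
  by rewrite [LHS]canon3_rot.
rewrite -[RHS]canon3_rot // -[RHS]canon3_rot //.
by move: us; rewrite -(rot_uniq 1).
Qed.

Lemma corner_triples_recolor s p : s \in colorings -> p \in colorings ->
  corner_triples (recolor s p) = [seq canon3 (recolor s t) | t <- corner_triples p].
Proof.
move=> cs cp; rewrite /corner_triples -map_comp; apply/eq_in_map => fs fs_in /=.
have [a [b [c [-> ufs lta ltb ltc]]]] :
  exists a b c, [/\ fs = [:: a; b; c], uniq fs, a < 6, b < 6 & c < 6].
  have : all (fun fs => [&& size fs == 3, uniq fs & all (gtn 6) fs]) corner_faces
    by [].
  move/allP/(_ _ fs_in); case: fs {fs_in} => [|a [|b [|c []]]] //.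
  by case/and3P=> _ ufs /and4P[]; exists a, b, c.
have nthE f : f < 6 -> nth 0 (recolor s p) f = nth 0 s (nth 0 p f).
  by move=> ltf; rewrite (nth_map 0) ?coloring_size.
rewrite /= !nthE // canon3_recolor // -!nthE //.
have cr := recolor_coloring cs cp.
rewrite -[X in uniq X]/(map (nth 0 (recolor s p)) [:: a; b; c]).
rewrite map_inj_in_uniq // => f g f_in g_in /eqP.
have lt6 h : h \in [:: a; b; c] -> h < 6 by rewrite !inE => /or3P[]/eqP->.
by rewrite nth_uniq ?coloring_size ?coloring_uniq ?lt6 // => /eqP.
Qed.

Lemma variety_ofP p : p \in colorings ->
  variety_of p < 30 /\ corner_triples (variety (variety_of p)) =i corner_triples p.
Proof.
move=> cp.
pose ok p := let v := variety_of p in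
  (v < 30) && all [in corner_triples p] (nth [::] variety_corners v).
have chk : all ok colorings by vm_cast_no_check (erefl true).
have : ok p by apply: (allP chk).
rewrite /ok /=; case/andP=> ltv /allP sub; split; first exact: ltv.
move=> t.
rewrite variety_cornersE ltv in sub.
apply/idP/idP => [/sub//|].
have : has (fun cv : seq (seq nat) => all [in cv] (corner_triples p))
  variety_corners.
  by rewrite has_find -[find _ _]/(variety_of p).
by move/(nth_find [::])/allP/(_ t); rewrite -/(variety_of p) variety_cornersE ltv.
Qed.

Lemma variety_of_mem p p' : corner_triples p =i corner_triples p' ->
  variety_of p = variety_of p'.
Proof.
move=> eqp; by apply: eq_find => cv; apply: eq_all_r.
Qed.

Lemma variety_of_variety V : V < 30 -> variety_of (variety V) = V.
Proof. move=> ltV; apply/eqP; move: V ltV; apply/all_iotaP;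
  vm_cast_no_check (erefl true). Qed.

Definition variety_act (s : seq nat) (V : nat) : nat :=
  variety_of (recolor s (variety V)).

Lemma act_lt s V : s \in colorings -> V < 30 -> variety_act s V < 30.
Proof. by move=> cs /variety_coloring cV; case:
  (variety_ofP (recolor_coloring cs cV)). Qed.

Lemma act_corners s V : s \in colorings -> V < 30 ->
  corner_triples (variety (variety_act s V)) =i
    [seq canon3 (recolor s t) | t <- corner_triples (variety V)].
Proof.
move=> cs /variety_coloring cV; rewrite -corner_triples_recolor //.
by case: (variety_ofP (recolor_coloring cs cV)).
Qed.

(** The function [variety_of] depends only on the set of corners, and there recoloring acts entry by
    entry. *)
Lemma actK s V : s \in colorings -> V < 30 ->
  variety_act (inverse s) (variety_act s V) = V.
Proof.
move=> cs ltV; have cV := variety_coloring ltV; have ci := inverse_coloring cs.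
transitivity (variety_of (variety V)); last exact: variety_of_variety.
rewrite {1}/variety_act; apply: variety_of_mem => t.
rewrite corner_triples_recolor ?variety_coloring ?act_lt //.
rewrite (eq_mem_map _ (act_corners cs ltV)) -corner_triples_recolor //.
by rewrite -corner_triples_recolor ?recolorK ?recolor_coloring.
Qed.

Lemma act_perm s : s \in colorings ->
  perm_eq [seq variety_act s V | V <- iota 0 30] (iota 0 30).
Proof.
move=> cs; have us : uniq [seq variety_act s V | V <- iota 0 30].
  rewrite map_inj_in_uniq ?iota_uniq // => V W; rewrite !mem_iota => ltV ltW eqVW.
  by rewrite -(actK cs ltV) eqVW actK.
have sub : {subset [seq variety_act s V | V <- iota 0 30] <= iota 0 30}.
  by move=> W /mapP[V ltV ->]; move: ltV; rewrite !mem_iota; apply: act_lt.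
apply: uniq_perm; rewrite ?iota_uniq //.
by have [] := uniq_min_size us sub; rewrite ?size_map.
Qed.

Lemma sum_act s (P : pred nat) m : s \in colorings ->
  \sum_(0 <= W < 30 | P W) m (variety_act (inverse s) W) =
    \sum_(0 <= V < 30 | P (variety_act s V)) m V.
Proof.
move=> cs; rewrite /index_iota subn0 -(perm_big _ (act_perm cs)) big_map.
rewrite big_seq_cond [RHS]big_seq_cond; apply: eq_bigr => V.
by rewrite mem_iota => /andP[ltV _]; rewrite actK.
Qed.

(** A set [C] that violates Hall's condition for [q] recolored by the inverse of [s] also violates
    it for [q] and the transported collection, since recoloring preserves shared corners and their
    numbering. *)
Lemma stuck_act s m : s \in colorings -> stuck m ->
  stuck (m \o variety_act (inverse s)).
Proof.
move=> cs bad q cq; have ci := inverse_coloring cs.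
have [C sC lt_sum] := bad _ (recolor_coloring ci cq).
exists C => //; apply: leq_ltn_trans lt_sum; rewrite sum_act //.
rewrite big_mkcond [leqRHS]big_mkcond /= big_nat [leqRHS]big_nat; apply:
  leq_sum => V ltV.
case: ifP => // /hasP[k Ck hit]; suff -> :
  hits (variety V) (recolor (inverse s) q) C by [].
apply/hasP; exists k => //; rewrite corner_triples_recolor // (nth_map [::]);
  last first.
  by rewrite size_map; case/andP: sC => _ /allP/(_ k Ck).
have cV := variety_coloring ltV.
move: hit; rewrite act_corners // =>
  /(map_f (fun t => canon3 (recolor (inverse s) t))).
by rewrite -!corner_triples_recolor ?recolorK ?recolor_coloring.
Qed.

(** * Induction over the classes of heavy sets *)

Lemma certificate_checked : all (all check_class) certificate.
Proof. vm_cast_no_check (erefl true). Qed.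

Lemma certificate_levels : [seq [seq c.1 | c <- cs] | cs <- certificate] = levels.
Proof. vm_cast_no_check (erefl levels). Qed.

Lemma mem_first_components (A B : eqType) (P : pred (A * B))
    (cs : seq (seq (A * B))) j x :
  x \in nth [::] [seq [seq c.1 | c <- c'] | c' <- cs] j -> all (all P) cs ->
  exists y, P (x, y).
Proof.
case: (ltnP j (size cs)) => [ltj|lej]; last by rewrite nth_default ?size_map.
rewrite (nth_map [::]) // => /mapP[[x' y] c_in ->] Pcs; exists y.
by apply: (allP (allP Pcs _ (mem_nth [::] ltj))).
Qed.

Lemma levels_size j R : R \in nth [::] levels j -> size R = j.
Proof.
have chk : all (fun j => all (fun R => size R == j) (nth [::] levels j)) (iota 0 7).
  by vm_cast_no_check (erefl true).
case: (ltnP j 7) => [ltj | lej]; last by rewrite nth_default.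
by move/all_iotaP: chk => /(_ j ltj)/allP/[apply]/eqP.
Qed.

Lemma zip_map_eq (A B : eqType) (P : A -> B -> bool) (f : A -> B) s t :
  size t = size s -> all (fun xy => P xy.1 xy.2) (zip s t) ->
  (forall x y, x \in s -> P x y -> y = f x) -> t = map f s.
Proof.
elim: s t => [|x s IH] [|y t] //= [eq_sz] /andP[Pxy al] fP.
rewrite (fP x y) ?mem_head //; congr (_ :: _); apply: IH => // x' y' sx'.
by apply: fP; rewrite inE sx' orbT.
Qed.

Lemma variety_corners_inj V W : V < 30 ->
  all [in nth [::] variety_corners W] (nth [::] variety_corners V) -> W = V.
Proof.
(* For [W] the check includes the index 30, which stands for all indices out of range, where [nth]
   gives the empty list. *)
have chk : all (fun V => all (fun W =>
   all [in nth [::] variety_corners W] (nth [::] variety_corners V) ==> (W == V))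
     (iota 0 31)) (iota 0 30).
  by vm_cast_no_check (erefl true).
move=> ltV; move/all_iotaP: chk => /(_ V ltV)/all_iotaP chk.
case: (ltnP W 30) => [ltW | leW]; first by move/implyP:
  (chk W (ltnW ltW)) => /[apply]/eqP.
have -> : nth [::] variety_corners W = nth [::] variety_corners 30
  by rewrite !nth_default.
by move/(implyP (chk 30 isT))/eqP => eqV; rewrite -eqV in ltV.
Qed.

Lemma act_unique s V W : s \in colorings -> V < 30 ->
  all [in nth [::] variety_corners W] (corner_triples (recolor s (variety V))) ->
    W = variety_act s V.
Proof.
move=> cs ltV sub; apply: variety_corners_inj; first exact: act_lt.
rewrite (variety_cornersE (variety_act s V)) act_lt //; apply/allP => t.
rewrite act_corners // -corner_triples_recolor ?variety_coloring //; exact: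
  (allP sub).
Qed.

Definition twice (R : seq nat) : seq nat := foldr (fun v s => v :: v :: s) [::] R.

Lemma mem_twice R : twice R =i R.
Proof. by elim: R => // v R IH V; rewrite !inE IH orbA orbb. Qed.

Lemma tracks_heavy m R : uniq R -> all (gtn 30) R -> {in R, forall V, 1 < m V} ->
  tracks m (twice R) (heavy_state R).
Proof.
elim: R => [_ _ _|v R IH /andP[vR uR] /andP[ltv ltR] mR]; first exact: tracks0.
have c0 : count_mem v (twice R) = 0 by apply/count_memPn; rewrite mem_twice.
have mv : 1 < m v by apply: mR; rewrite mem_head.
have tr : tracks m (twice R) (heavy_state R).
  by apply: IH => // V VR; apply: mR; rewrite inE VR orbT.
rewrite /=; apply: tracks_place => //=; first by rewrite eqxx c0.
by apply: tracks_place; rewrite ?c0 // ltnW.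
Qed.

(** Downward induction on the level. If some variety outside [R] is heavy, a permutation of the
    colors moves it together with [R] to a representative of the next level, and the total is
    preserved. Otherwise [R] is the whole heavy set and the search over light varieties applies. *)
Lemma heavy_class_sum j R m : R \in nth [::] levels j -> stuck m ->
  {in R, forall V, 1 < m V} -> \sum_(0 <= V < 30) m V < 24.
Proof.
elim: {j}(7 - j) {-2}j (erefl (7 - j)) R m => [|d IH] j def_d R m Rj bad mR.
  (* There are only the levels 0 to 6. *)
  by move: Rj; rewrite nth_default // -subn_eq0 def_d.
have szR := levels_size Rj.
have ltj : j < 7 by rewrite ltnNge -subn_eq0 def_d.
have [ws chk] : exists ws, check_class (R, ws).
  apply: (@mem_first_components _ _ check_class certificate j R _
    certificate_checked).
  by rewrite certificate_levels.
case/and4P: chk => uR ltR nl ext.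
have tr := tracks_heavy uR ltR mR.
case: (boolP (has (fun v => (v \notin R) && (1 < m v)) (iota 0 30))) =>
  [/hasP[v]|/hasPn only].
  rewrite mem_iota add0n /= => ltv /andP[vR mv].
  have mvR : {in v :: R, forall V, 1 < m V} by move=> V;
    rewrite inE => /orP[/eqP->|/mR].
  have ltvR V : V \in v :: R -> V < 30 by rewrite inE => /orP[/eqP->|/(allP ltR)].
  have uvR : uniq (v :: R) by rewrite /= vR.
  have trv : tracks m (twice (v :: R)) (heavy_state (v :: R)).
    by apply: tracks_heavy => //; apply/andP.
  move/all_iotaP: ext => /(_ v ltv).
  (* The collection is unfillable, so two cubes of [v] do not make the state dead and the
     certificate must hold a checked witness. *)
  rewrite (negPf vR) (negPf (deadN bad trv)) /=.
  case: (nth _ ws v) => s im; rewrite /check_witness -/(size (v :: R)) => /and4P[].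
  rewrite -mem_colorings => cs /eqP sz_im al /hasP[R' R'in sub].
  have imE : im = map (variety_act s) (v :: R).
    apply: zip_map_eq sz_im al _ => V W /ltvR ltV; exact: act_unique.
  have inj : {in v :: R &, injective (variety_act s)}.
    by move=> V W /ltvR ltV /ltvR ltW eqVW; rewrite -(actK cs ltV) eqVW actK.
  have [_ eqR'] : (size im = size R') * (im =i R').
    apply: uniq_min_size; [by rewrite imE map_inj_in_uniq | exact/allP |].
    by rewrite (levels_size R'in) sz_im.
  have := IH j.+1 _ R' (m \o variety_act (inverse s)); rewrite (sum_act predT) //;
    apply.
  - by rewrite subnS def_d.
  - by move: R'in; rewrite /= szR.
  - exact: stuck_act.
  move=> W; rewrite -eqR' imE => /mapP[V VvR ->] /=.
  by rewrite actK ?ltvR // mvR.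
apply: (no_lightP (H := R) (L := [::]) bad tr _ _ _ _ _ _ nl).
- by move=> V; rewrite cats0 mem_twice.
- rewrite cat0s cat_uniq uR filter_uniq ?iota_uniq // andbT; apply/hasPn => V.
  by rewrite mem_filter => /andP[].
- rewrite cat0s all_cat ltR; apply/allP => V.
  by rewrite mem_filter mem_iota => /andP[].
- move=> V ltV; apply/idP/idP => [/mR//|mV]; move: (only V);
    rewrite mem_iota mV andbT negbK.
  by apply.
- by [].
by move=> V ltV _; rewrite cat0s mem_cat mem_filter mem_iota ltV /=; case:
  (V \in R).
Qed.

Theorem stuck_sum m : stuck m -> \sum_(0 <= V < 30) m V < 24.
Proof. by move=> bad; apply: (@heavy_class_sum 0 [::]). Qed.

(** * Edges *)

Definition sort2 (a b : nat) : seq nat := if a < b then [:: a; b] else [:: b; a].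

Definition opposites (p : seq nat) : seq (seq nat) :=
  [seq sort2 (nth 0 p f) (nth 0 p f.+1) | f <- [:: 0; 2; 4]].

Definition edge_faces : seq (seq nat) :=
  [:: [:: 0; 2]; [:: 0; 3]; [:: 0; 4]; [:: 0; 5]; [:: 1; 2]; [:: 1; 3];
      [:: 1; 4]; [:: 1; 5]; [:: 2; 4]; [:: 2; 5]; [:: 3; 4]; [:: 3; 5]].

Definition edge_colors (q e : seq nat) : seq nat :=
  sort2 (nth 0 q (nth 0 e 0)) (nth 0 q (nth 0 e 1)).

Definition edge_set (E : seq (seq nat)) : bool := uniq E && all [in edge_faces] E.

Definition fits (p q C : seq nat) (E : seq (seq nat)) : bool :=
  hits p q C || has (fun e => edge_colors q e \notin opposites p) E.

Definition variety_opposites : seq (seq (seq nat)) :=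
  Eval vm_compute in map opposites varieties.

Definition opp (V : nat) : seq (seq nat) := nth [::] variety_opposites V.

Lemma oppE V : V < 30 -> opposites (variety V) = opp V.
Proof.
by move=> ltV; apply/eqP; move: V ltV; apply/all_iotaP;
  vm_cast_no_check (erefl true).
Qed.

Lemma size_opp V : size (opp V) <= 3.
Proof.
case: (ltnP V 30) => [ltV|leV]; last by rewrite [opp V]nth_default.
by move: V ltV; apply/all_iotaP; vm_cast_no_check (erefl true).
Qed.

Lemma edge_colors_uniq q E : q \in colorings -> edge_set E ->
  uniq (map (edge_colors q) E).
Proof.
pose ok q := uniq (map (edge_colors q) edge_faces).
have chk : all ok colorings by vm_cast_no_check (erefl true).
move=> cq /andP[uE /allP subE]; have uq : ok q by apply: (allP chk).
have pE : perm_eq E [seq e <- edge_faces | e \in E].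
  apply: uniq_perm => [//||e]; first by rewrite filter_uniq.
  by rewrite mem_filter andb_idr // => /subE.
rewrite (perm_uniq (perm_map _ pE)); apply: subseq_uniq uq.
by apply: map_subseq; apply: filter_subseq.
Qed.

Definition with_opp (m : nat -> nat) (x : seq nat) : nat :=
  \sum_(0 <= V < 30 | x \in opp V) m V.
Definition with_opp2 (m : nat -> nat) (x y : seq nat) : nat :=
  \sum_(0 <= V < 30 | (x \in opp V) && (y \in opp V)) m V.

(** This is Hall's condition for the 8 corners and 12 edges of the frame when the big cube is
    colored by [q]. *)
Definition good (m : nat -> nat) (q : seq nat) : Prop := forall C E, corner_set C ->
  edge_set E ->
  size C + size E <= \sum_(0 <= V < 30 | fits (variety V) q C E) m V.

Lemma corner_set_size C : corner_set C -> size C <= 8.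
Proof.
case/andP=> uC /allP ltC; rewrite -(size_iota 0 8) uniq_leq_size // => k kC.
by rewrite mem_iota; apply: (ltC _ kC).
Qed.

Lemma edge_set_size E : edge_set E -> size E <= 12.
Proof. by case/andP=> uE /allP subE; apply: (uniq_leq_size uE subE). Qed.

Lemma sum_fitsE m q C E : \sum_(0 <= V < 30) m V = 24 ->
  24 = \sum_(0 <= V < 30 | fits (variety V) q C E) m V
     + \sum_(0 <= V < 30 | ~~ fits (variety V) q C E) m V.
Proof. by move=> sum_m; rewrite -[LHS]sum_m
  (bigID (fun V => fits (variety V) q C E)). Qed.

Lemma unfit_opp V q C E e : V < 30 -> ~~ fits (variety V) q C E -> e \in E ->
  edge_colors q e \in opp V.
Proof.
move=> ltV /norP[_ /hasPn noE] eE; rewrite -oppE //.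
by have := noE e eE; rewrite negbK.
Qed.

Lemma leq_sum_cond m (P Q : pred nat) : (forall V, V < 30 -> P V -> Q V) ->
  \sum_(0 <= V < 30 | P V) m V <= \sum_(0 <= V < 30 | Q V) m V.
Proof.
move=> PQ; rewrite big_mkcond [leqRHS]big_mkcond big_nat [leqRHS]big_nat.
by apply: leq_sum => V ltV; case: ifP => // /PQ ->.
Qed.

(** A cube that fits on none of four edges would have four pairs of opposite colors. So all 24 cubes
    fit somewhere, and there are only 20 positions. *)
Lemma four_edges m q C E : \sum_(0 <= V < 30) m V = 24 ->
  q \in colorings -> corner_set C -> edge_set E -> 3 < size E ->
  size C + size E <= \sum_(0 <= V < 30 | fits (variety V) q C E) m V.
Proof.
move=> sum_m cq sC sE ltE; have := sum_fitsE q C E sum_m.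
rewrite [X in _ = _ + X]big_nat_cond [X in _ = _ + X]big1 => [|V]; last first.
  case/andP=> ltV unfit; have := edge_colors_uniq cq sE => uE; exfalso.
  have : size (map (edge_colors q) E) <= size (opp V).
    by apply: uniq_leq_size => // _ /mapP[e eE ->]; apply: unfit_opp unfit eE.
  by have := size_opp V; rewrite size_map; lia.
by have := corner_set_size sC; have := edge_set_size sE; lia.
Qed.

(** With two or three edges there are at most 8 + 3 = 11 positions, and at most 13 = 24 - 11 cubes
    fit on none of them. *)
Lemma two_edges m q C E : \sum_(0 <= V < 30) m V = 24 ->
  q \in colorings -> corner_set C -> edge_set E -> 1 < size E ->
  (forall x y, x != y -> with_opp2 m x y <= 13) ->
  size C + size E <= \sum_(0 <= V < 30 | fits (variety V) q C E) m V.
Proof.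
move=> sum_m cq sC sE gt1 le13; case: (ltnP 3 (size E)) => [|le3]; first exact:
  four_edges.
have := edge_colors_uniq cq sE; have := sum_fitsE q C E sum_m.
case: E sE gt1 le3 => [|e [|f E]] // sE _ le3 sumE /andP[/norP[ef _] _].
have : \sum_(0 <= V < 30 | ~~ fits (variety V) q C [:: e, f & E]) m V <= 13.
  apply: leq_trans (le13 _ _ ef); apply: leq_sum_cond => V ltV unfit.
  by rewrite !(unfit_opp ltV unfit) // !inE eqxx ?orbT.
have := corner_set_size sC; move: le3 sumE => /=; lia.
Qed.

(** A single edge leaves at most 8 + 1 = 9 positions, which explains the bound 15 = 24 - 9. Without
    edges the condition is the fillability of the corners. *)
Lemma good_spread m q : \sum_(0 <= V < 30) m V = 24 ->
  q \in colorings -> ~ unfillable m q ->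
  (forall x, with_opp m x <= 15) -> (forall x y, x != y -> with_opp2 m x y <= 13) ->
    good m q.
Proof.
move=> sum_m cq fill le15 le13 C E sC sE.
case: (ltnP 1 (size E)) => [gt1|]; first exact: two_edges.
case: E sE => [|e [|//]] sE _.
  rewrite addn0 leqNgt; apply/negP => lt; apply: fill; exists C => //.
  by apply: leq_ltn_trans lt; apply: leq_sum_cond => V _; rewrite /fits => ->.
have := sum_fitsE q C [:: e] sum_m.
have : \sum_(0 <= V < 30 | ~~ fits (variety V) q C [:: e]) m V <= 15.
  apply: leq_trans (le15 (edge_colors q e)); apply: leq_sum_cond => V ltV unfit.
  by rewrite (unfit_opp ltV unfit) ?mem_head.
have := corner_set_size sC; rewrite [size [:: e]]/=; lia.
Qed.

Lemma sum_hits_fits m q C E :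
  \sum_(0 <= V < 30 | hits (variety V) q C) m V
    <= \sum_(0 <= V < 30 | fits (variety V) q C E) m V.
Proof. by apply: leq_sum_cond => V _; rewrite /fits => ->. Qed.

Lemma leq_sum_sub m (P : pred nat) s : uniq s -> all (gtn 30) s ->
  \sum_(V <- s | P V) m V <= \sum_(0 <= V < 30 | P V) m V.
Proof.
move=> us lts; have ps : perm_eq s [seq V <- iota 0 30 | V \in s].
  apply: uniq_perm => [//||V]; first by rewrite filter_uniq ?iota_uniq.
  by rewrite mem_filter mem_iota andb_idr // => /(allP lts).
rewrite (perm_big _ ps) big_filter_cond /index_iota subn0.
rewrite big_mkcond [leqRHS]big_mkcond; apply: leq_sum => V _.
by case: (V \in s); case: (P V).
Qed.

(** * Collections in which many cubes share opposite colors *)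

Definition color_pairs : seq (seq nat) := undup (flatten variety_opposites).

Lemma opp_color_pairs V x : x \in opp V -> x \in color_pairs.
Proof.
move=> xV; rewrite mem_undup; apply/flattenP; exists (opp V) => //.
case: (ltnP V 30) => [ltV|leV]; first by rewrite mem_nth.
by move: xV; rewrite [opp V]nth_default.
Qed.

Lemma sum_gt0_exists m (P : pred nat) : 0 < \sum_(0 <= V < 30 | P V) m V ->
  exists2 V, V < 30 & P V.
Proof.
move=> gt0; case: (boolP (has P (iota 0 30))) => [/hasP[V]|/hasPn nP].
  by rewrite mem_iota; exists V.
by rewrite big_seq_cond big1 // in gt0 => V /andP[Vin PV]; move: (nP V Vin);
  rewrite PV.
Qed.

Lemma sum_filter m (P : pred nat) :
  \sum_(0 <= V < 30 | P V) m V = \sum_(V <- [seq V <- iota 0 30 | P V]) m V.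
Proof. by rewrite big_filter /index_iota subn0. Qed.

Lemma edge_not_opp T e : T < 30 -> e \in edge_faces ->
  edge_colors (variety T) e \notin opp T.
Proof.
have chk : all (fun T => all (fun e => edge_colors (variety T) e \notin opp T)
  edge_faces) (iota 0 30).
  by vm_cast_no_check (erefl true).
by move=> ltT eE; move/all_iotaP: chk => /(_ T ltT)/allP; apply.
Qed.

Definition twins_ok (x y : seq nat) : bool :=
  if x == y then true else
  match [seq V <- iota 0 30 | (x \in opp V) && (y \in opp V)] with
  | [::] => true
  | [:: T; T'] =>
      [&& T < 30, T' < 30, T != T', all [in opp T] (opp T'), all [in opp T'] (opp T)
        & all (fun W => (shared W T != [::]) || (shared W T' != [::])) (iota 0 30)]
  | _ => false
  end.

Lemma twins_checked : all (fun x => all (twins_ok x) color_pairs) color_pairs.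
Proof. vm_cast_no_check (erefl true). Qed.

(* Two varieties with the same opposite colors are mirror images of each other. *)
Lemma opp2_twins x y V : x != y -> x \in opp V -> y \in opp V ->
  exists T T', [/\ (T < 30) && (T' < 30), T != T', opp T =i opp T',
    [seq V <- iota 0 30 | (x \in opp V) && (y \in opp V)] = [:: T; T']
    & forall W, W < 30 -> (shared W T != [::]) || (shared W T' != [::])].
Proof.
move=> neq_xy xV yV.
have : twins_ok x y.
  exact: (allP (allP twins_checked x (opp_color_pairs xV)) y (opp_color_pairs yV)).
have ltV : V < 30 by rewrite ltnNge; apply: contraL xV => leV;
  rewrite [opp V]nth_default.
have : V \in [seq V <- iota 0 30 | (x \in opp V) && (y \in opp V)].
  by rewrite mem_filter xV yV mem_iota.
rewrite /twins_ok (negPf neq_xy); case: [seq V <- iota 0 30 | _] =>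
  [|T [|T' []]] // _.
case/and5P=> ltT ltT' TT' /allP o1 /andP[/allP o2 /all_iotaP sh]; exists T, T';
  split=> //; first exact/andP.
by move=> z; apply/idP/idP => [/o2|/o1].
Qed.

(** At least 14 cubes belong to a mirror pair [T], [T'], and one of the two is taken as the big
    cube. These cubes fit on all its edges and suffice for up to 8 corners and 3 edges, so only sets
    of corners alone need care. *)
Lemma good_twins m x y : \sum_(0 <= V < 30) m V = 24 -> x != y ->
  13 < with_opp2 m x y ->
  exists2 q, q \in colorings & good m q.
Proof.
move=> sum_m neq_xy gt13.
have [|V ltV /andP[xV yV]] :=
  @sum_gt0_exists m (fun V => (x \in opp V) && (y \in opp V)).
  by apply: leq_trans gt13.
have [T [T' [/andP[ltT ltT'] TT' oppT def_s useful]]] := opp2_twins neq_xy xV yV.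
move: gt13; rewrite /with_opp2 sum_filter def_s !big_cons big_nil addn0 => gt13.
have cover : 24 <= \sum_(0 <= V < 30 | shared V T != [::]) m V + \sum_(0 <=
  V < 30 | shared V T' != [::]) m V.
  rewrite -[leqLHS]sum_m [X in _ <= X + _]big_mkcond [X in _ <= _ + X]big_mkcond
    -big_split /= big_nat [leqRHS]big_nat.
  by apply: leq_sum => W ltW; case/orP: (useful W ltW) => ->;
    rewrite ?leq_addr ?leq_addl.
(* If neither [T] nor [T'] has eight cubes, both have seven. Every variety shares a corner with one
   of them, so one of them shares a corner with at least twelve of the 24 cubes. *)
have [U [ltU oU mU uU]] : exists U, [/\ U < 30, opp U =i opp T, 6 < m U &
     7 < m U \/ 7 < \sum_(0 <= V < 30 | shared V U != [::]) m V].
  case: (ltnP 7 (m T)) => mT; first by exists T; split=> //; [apply: ltnW | left].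
  case: (ltnP 7 (m T')) => mT'.
    by exists T'; split=> //; [apply: ltnW | left].
  case: (ltnP 7 (\sum_(0 <= V < 30 | shared V T != [::]) m V)) => uT.
    by exists T; split=> //; [lia | right].
  by exists T'; split=> //; [lia | right; lia].
have both W C E e : W \in [:: T; T'] -> e \in E -> e \in edge_faces ->
  fits (variety W) (variety U) C E.
  move=> WT eE eF; apply/orP; right; apply/hasP; exists e => //.
  have ltW : W < 30 by move: WT; rewrite !inE => /orP[]/eqP->.
  rewrite oppE //; apply: contra (edge_not_opp ltU eF).
  by move: WT; rewrite !inE oU => /orP[]/eqP-> //; rewrite -oppT.
exists (variety U); first exact: variety_coloring.
move=> C E sC sE.
case: (ltnP 3 (size E)) => [gt3|le3]; first by apply: four_edges => //; apply:
  variety_coloring.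
have le8 := corner_set_size sC.
case: E sE le3 => [|e E] sE le3; last first.
  have eF : e \in edge_faces by case/andP: sE => _ /andP[].
  apply: leq_trans (leq_sum_sub m (fun V => fits (variety V) (variety U) C (e :: E))
    (s := [:: T; T']) _ _).
  - have fT W : W \in [:: T; T'] -> fits (variety W) (variety U) C (e :: E).
      by move=> WT; apply: both WT (mem_head _ _) eF.
    rewrite !big_cons big_nil !fT ?mem_head ?inE ?eqxx ?orbT //.
    by rewrite addn0; apply: leq_trans (leq_add le8 le3) _; apply: leq_trans gt13.
  - by rewrite /= inE TT'.
  - by rewrite /= ltT ltT'.
rewrite addn0; apply: leq_trans (sum_hits_fits _ _ _ _).
case: (posnP (size C)) => [-> //|C0]; rewrite sum_hits_self //.
case: uU => [|uU]; first by lia.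
(* Seven cubes of variety [U] serve up to seven corners. For all eight, every cube that shares any
   corner with [U] counts. *)
case: (ltnP (size C) 8) => [|ge8]; first by lia.
rewrite -sum_hits_self // sum_hits //; apply: leq_trans le8 _; apply:
  leq_trans uU _.
apply: leq_sum_cond => W ltW ne.
have subC : {subset iota 0 8 <= C}.
  case/andP: sC => uC /allP ltC.
  have sub8 : {subset C <= iota 0 8} by move=> k /ltC; rewrite mem_iota.
  have [_ eqC] : (size C = size (iota 0 8)) * (C =i iota 0 8).
    by apply: uniq_min_size; rewrite ?size_iota.
  by move=> k; rewrite eqC.
move: ne; rewrite sharedE //; case def_s' : [seq k <- iota 0 8 | _] => [//|k s'] _.
apply/hasP; exists k; first exact: mem_head.
have : k \in k :: s' by rewrite mem_head.
by rewrite -def_s' mem_filter => /andP[_ /subC].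
Qed.

Definition mirror (V : nat) : nat :=
  find (fun W => (W != V) && all [in opp V] (opp W)) (iota 0 30).

Definition same_opp (x : seq nat) : seq nat := [seq V <- iota 0 30 | x \in opp V].

(* The six varieties with the opposite colors [x] form three mirror pairs; the four
   that are not in the pair of [T] share disjoint pairs of corners with [T]. *)
Definition sextet_of (T : nat) (x : seq nat) : seq nat :=
  let T' := mirror T in
  let rest := [seq V <- same_opp x | V \notin [:: T; T']] in
  let U := head 0 rest in let U' := mirror U in
  [:: T, T', U, U' & [seq V <- rest | V \notin [:: U; U']]].

Definition sextet_ok (T : nat) (x : seq nat) : bool :=
  if sextet_of T x is [:: T0; T'; U; U'; W; W'] then
    [&& perm_eq (same_opp x) [:: T; T'; U; U'; W; W'],
        perm_eq (shared U T ++ shared U' T ++ shared W T ++ shared W' T) (iota 0 8),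
        all (fun V => size (shared V T) == 2) [:: U; U'; W; W'],
        [&& all [in opp T] (opp T'), all [in opp U'] (opp U),
          all [in opp U] (opp U'),
            all [in opp W'] (opp W) & all [in opp W] (opp W')]
      & all (fun y => (y == x) || (y \notin opp W)) (opp U)]
  else false.

Lemma sextet_checked : all (fun T => all (sextet_ok T) (opp T)) (iota 0 30).
Proof. vm_cast_no_check (erefl true). Qed.

Lemma exists_argmax (m : nat -> nat) (s : seq nat) : 0 < size s ->
  exists2 T, T \in s & {in s, forall V, m V <= m T}.
Proof.
elim: s => // V [_ _|W s IH _]; first by exists V => [|U];
  rewrite ?mem_head // inE => /eqP->.
have [//|T Ts maxT] := IH; case: (leqP (m V) (m T)) => [leVT|ltTV].
  exists T; first by rewrite inE Ts orbT.
  by move=> U; rewrite inE => /orP[/eqP->|/maxT].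
exists V; first exact: mem_head.
by move=> U; rewrite inE => /orP[/eqP->//|/maxT/leq_trans]; apply; apply: ltnW.
Qed.

Lemma sextetP T x : T < 30 -> x \in opp T -> exists T' U U' W W',
  [/\ perm_eq (same_opp x) [:: T; T'; U; U'; W; W'],
      perm_eq (shared U T ++ shared U' T ++ shared W T ++ shared W' T) (iota 0 8),
      all (fun V => size (shared V T) == 2) [:: U; U'; W; W'],
      [/\ {subset opp T' <= opp T}, opp U' =i opp U & opp W' =i opp W]
    & forall y, y != x -> y \in opp U -> y \notin opp W].
Proof.
move=> ltT xT; have : sextet_ok T x.
  by move/all_iotaP: sextet_checked => /(_ T ltT)/allP; apply.
rewrite /sextet_ok; case: (sextet_of T x) =>
  [|T0 [|T' [|U [|U' [|W [|W' []]]]]]] //.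
case/and5P=> pS pC sz /and5P[/allP o1 /allP o2 /allP o3 /allP o4 /allP o5] /allP
  dis.
exists T', U, U', W, W'; split=> //.
  by split=> [//|y|y]; apply/idP/idP; [exact: o3|exact: o2|exact: o5|exact: o4].
by move=> y ne yU; move: (dis y yU); rewrite (negPf ne).
Qed.

Lemma count_le_has (C s : seq nat) : size s = 2 ->
  count [in C] s <= 2 * has [in C] s.
Proof. by case: s => [|a [|b []]] //= _; case: (a \in C); case: (b \in C). Qed.

Lemma big_cond6 (m : nat -> nat) (P : pred nat) a b c d e f :
  \sum_(V <- [:: a; b; c; d; e; f] | P V) m V
  = (if P a then m a else 0) + ((if P b then m b else 0) + ((if P c then m c else 0)
    + ((if P d then m d else 0) +
      ((if P e then m e else 0) + (if P f then m f else 0))))).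
Proof. by rewrite big_mkcond /= !big_cons big_nil addn0. Qed.

(** If [h] of the last four varieties are counted, then [c] is at most [2 * h]. Either [t] alone
    reaches this, or the at most [5 - h] varieties left out have at most [2 * h - 1] cubes each, and
    at least [2 * h] of the 16 cubes remain. *)
Lemma sextet_corner_bound t t' u u' w w' c (ht' hu hu' hw hw' : bool) :
  t' <= t -> u <= t -> u' <= t -> w <= t -> w' <= t ->
  15 < t + (t' + (u + (u' + (w + w')))) ->
  c <= 2 * hu + (2 * hu' + (2 * hw + 2 * hw')) ->
  c <= t + ((if ht' then t' else 0) +
    ((if hu then u else 0) + ((if hu' then u' else 0)
         + ((if hw then w else 0) + (if hw' then w' else 0))))).
Proof.
by case: ht'; case: hu => /=; case: hu' => /=; case: hw => /=; case: hw' => /=; lia.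
Qed.

(** The [r] cubes fit on the edge in any case. As [u] and [u'] are at most [r], the number [r] is at
    least 6 and [r] with one of them at least 8. The corresponding bounds on [c] are 4 and 6, and
    with both it is 8 against 16. *)
Lemma sextet_edge_bound t u u' r c (hu hu' : bool) :
  u <= t -> u' <= t -> t <= r -> 15 < r + (u + u') -> c <= 2 * hu + (2 * hu' + 4) ->
  c < r + ((if hu then u else 0) + (if hu' then u' else 0)).
Proof. by case: hu; case: hu' => /=; lia. Qed.

(** The big cube takes the most frequent variety [T] among the six with opposite colors [x]. Cubes
    of [T] and its mirror image fit on every edge. The other two mirror pairs have only [x] in
    common, so a given edge excludes at most one of them. *)
Lemma good_sextet m x : \sum_(0 <= V < 30) m V = 24 -> 15 < with_opp m x ->
  (forall x y, x != y -> with_opp2 m x y <= 13) -> exists2 q, q \in colorings &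
    good m q.
Proof.
move=> sum_m gt15 le13.
have defS : with_opp m x = \sum_(V <- same_opp x) m V
  by rewrite /same_opp -sum_filter.
rewrite defS in gt15.
have [|T Tx maxT] := @exists_argmax m (same_opp x).
  by case: (same_opp x) gt15 => //; rewrite big_nil.
have [xT ltT] : x \in opp T /\ T < 30.
  by move: Tx; rewrite mem_filter mem_iota => /andP[].
have cT := variety_coloring ltT.
have [T' [U [U' [W [W' [pS pC sz [oT oU oW] dis]]]]]] := sextetP ltT xT.
set S6 := [:: T; T'; U; U'; W; W'] in pS.
have uS : uniq S6 by rewrite -(perm_uniq pS) filter_uniq ?iota_uniq.
have ltS : all (gtn 30) S6.
  by apply/allP => V; rewrite -(perm_mem pS) mem_filter mem_iota => /andP[].
have maxS V : V \in S6 -> m V <= m T by rewrite -(perm_mem pS); apply: maxT.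
have leT' : m T' <= m T by apply: maxS; rewrite !inE eqxx ?orbT.
have leU : m U <= m T by apply: maxS; rewrite !inE eqxx ?orbT.
have leU' : m U' <= m T by apply: maxS; rewrite !inE eqxx ?orbT.
have leW : m W <= m T by apply: maxS; rewrite !inE eqxx ?orbT.
have leW' : m W' <= m T by apply: maxS; rewrite !inE eqxx ?orbT.
have sumS : \sum_(V <- same_opp x) m V = \sum_(V <- S6) m V by apply: perm_big.
move: gt15; rewrite sumS /S6 !big_cons big_nil addn0 => gt15.
case/and5P: (ltS) => _ ltT' ltU ltU' /and3P[ltW ltW' _].
case/and5P: sz => /eqP szU /eqP szU' /eqP szW /eqP szW' _.
exists (variety T) => // C E sC sE.
case: (ltnP 1 (size E)) => [gt1|le1]; first exact: two_edges.
have le8 := corner_set_size sC.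
have sizeC : size C <= 2 * has [in C] (shared U T) + (2 * has [in C] (shared U' T)
     + (2 * has [in C] (shared W T) + 2 * has [in C] (shared W' T))).
  have <- : count [in C] (iota 0 8) = size C.
    by rewrite -(count_singletons sC); apply: eq_count => k; rewrite /= andbT.
  by rewrite -(seq.permP pC) !count_cat !leq_add ?count_le_has.
apply: leq_trans (leq_sum_sub m _ uS ltS); rewrite big_cond6.
case: E sE le1 => [|e [|//]] sE _.
  rewrite addn0 /fits !orbF; case: (posnP (size C)) => [-> //|C0].
  have hT : hits (variety T) (variety T) C.
    rewrite hits_shared // shared_self //; case:
      C sC C0 {sizeC le8} => // k C /andP[_ /andP[ltk _]] _.
    by apply/hasP; exists k; rewrite ?mem_head // mem_iota.
  rewrite hT !(hits_shared _ ltT sC) //.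
  exact: sextet_corner_bound leT' leU leU' leW leW' gt15 sizeC.
have eF : e \in edge_faces by case/andP: sE => _ /andP[].
have yT := edge_not_opp ltT eF.
rewrite /fits !has_seq1 !oppE // yT orbT.
have yT' : edge_colors (variety T) e \notin opp T' by apply: contra yT => /oT.
have yx : edge_colors (variety T) e != x by apply: contraNneq yT => ->.
rewrite yT' orbT oU oW !(hits_shared _ ltT sC) //.
rewrite [size [:: e]]/= addn1; have := dis _ yx.
have le4 (a b : bool) : 2 * a + 2 * b <= 4 by case: a; case: b.
clear -leT' leU leU' leW leW' gt15 sizeC le8 le4.
case: (_ \in opp U) => [/(_ isT) /negPf->|_]; rewrite /= ?orbT ?orbF.
  have := @sextet_edge_bound (m T) (m U) (m U') (m T + (m T' + (m W + m W')))
    (size C)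
    (has [in C] (shared U T)) (has [in C] (shared U' T)).
  have := le4 (has [in C] (shared W T)) (has [in C] (shared W' T)).
  move: (if _ then _ else _) (if _ then _ else _) => a b; lia.
case: (_ \in opp W); rewrite /= ?orbT ?orbF.
  have := @sextet_edge_bound (m T) (m W) (m W') (m T + (m T' + (m U + m U')))
    (size C)
    (has [in C] (shared W T)) (has [in C] (shared W' T)).
  have := le4 (has [in C] (shared U T)) (has [in C] (shared U' T)).
  move: (if _ then _ else _) (if _ then _ else _) => a b; lia.
(* The edge excludes neither mirror pair, so all sixteen cubes fit on it. *)
by apply: leq_trans gt15; apply: leq_ltn_trans le8 _.
Qed.

Definition unfillableb (m : nat -> nat) (q : seq nat) : bool :=
  has (fun C => \sum_(0 <= V < 30 | hits (variety V) q C) m V < size C)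
      (subseqs (iota 0 8)).

Lemma unfillableP m q : reflect (unfillable m q) (unfillableb m q).
Proof.
apply: (iffP hasP) => [[C Cin lt]|[C sC lt]].
  exists C => //; have : all corner_set (subseqs (iota 0 8)) by [].
  by move/allP; apply.
exists [seq k <- iota 0 8 | k \in C]; first exact: filter_subseqs.
have eqC : [seq k <- iota 0 8 | k \in C] =i C.
  move=> k; rewrite mem_filter mem_iota andb_idr //.
  by case/andP: sC => _ /allP ltC /ltC.
have -> : size [seq k <- iota 0 8 | k \in C] = size C.
  case/andP: sC => uC _; apply/perm_size/uniq_perm => //.
  by rewrite filter_uniq ?iota_uniq.
by under eq_bigl => V do rewrite /hits (eq_has_r eqC).
Qed.

Theorem selection m : \sum_(0 <= V < 30) m V = 24 ->
  exists2 q, q \in colorings & good m q.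
Proof.
move=> sum_m.
case: (boolP (all (fun x => all (fun y => (x == y) || (with_opp2 m x y <= 13))
  color_pairs) color_pairs)) => [/allP le2|/allPn[x xP /allPn[y yP]]]; last first.
  by rewrite negb_or -ltnNge => /andP[]; apply: good_twins.
have le13 x y : x != y -> with_opp2 m x y <= 13.
  move=> xy; case: (boolP (x \in color_pairs)) => [/le2/allP le_x|xP]; last first.
    rewrite /with_opp2 big1 // => V /andP[/opp_color_pairs xV]; by rewrite xV in xP.
  case: (boolP (y \in color_pairs)) => [/le_x|yP]; first by rewrite (negPf xy).
  rewrite /with_opp2 big1 // => V /andP[_ /opp_color_pairs yV]; by rewrite yV in yP.
case: (boolP (all (fun x => with_opp m x <= 15) color_pairs)) =>
  [/allP le1|/allPn[x xP]]; last first.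
  by rewrite -ltnNge => gt15; apply: good_sextet gt15 le13.
have le15 x : with_opp m x <= 15.
  case: (boolP (x \in color_pairs)) => [/le1//|xP].
  rewrite /with_opp big1 // => V /opp_color_pairs xV; by rewrite xV in xP.
case: (boolP (all (unfillableb m) colorings)) =>
  [/allP all_bad|/allPn[q cq /unfillableP fill]].
  have /stuck_sum : stuck m by move=> q /all_bad/unfillableP.
  by rewrite sum_m.
by exists q; last exact: good_spread.
Qed.

(** * Hall's theorem *)

Definition neighbors (X Y : finType) (r : X -> Y -> bool)
    (B : {set Y}) (A : {set X}) : {set Y} :=
  [set y in B | [exists x in A, r x y]].

(** If a nonempty proper subset [A0] of [D] is tight, it is matched into its neighbors and the rest
    of [D] into the other elements of [B]. If none is tight, [x0] may take any neighbor, since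
    removing one element of [B] uses up at most the surplus. The set [B] varies in the induction,
    and [y0] is a value for points outside [D]. *)
Lemma hall_within (X Y : finType) (r : X -> Y -> bool)
    (y0 : Y) (D : {set X}) (B : {set Y}) :
  (forall A : {set X}, A \subset D -> #|A| <= #|neighbors r B A|) ->
  exists2 f : X -> Y, {in D &, injective f}
    & {in D, forall x, (f x \in B) && r x (f x)}.
Proof.
elim: {D}#|D| {-2}D (leqnn #|D|) B => [|n IH] D leDn B hallD.
  have D0 : D = set0 by apply/eqP; rewrite -cards_eq0 -leqn0.
  by exists (fun=> y0) => [x x'|x]; rewrite D0 inE.
case: (set_0Vmem D) => [->|[x0 Dx0]]; first by exists (fun=> y0) => [x x'|x];
  rewrite inE.
case: (boolP [exists A : {set X}, [&& A \proper D, A != set0 & #|neighbors r B A| <=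
  #|A|]]).
  case/existsP=> A0 /and3P[prA0 ntA0 tight]; pose B0 := neighbors r B A0.
  have sA0D := proper_sub prA0; have ltA0 := proper_card prA0.
  have le0 : #|A0| <= n by rewrite -ltnS; apply: leq_trans leDn.
  have hall0 (A : {set X}) : A \subset A0 -> #|A| <= #|neighbors r B0 A|.
    move=> sAA0; apply: leq_trans (hallD A (subset_trans sAA0 sA0D)) _.
    apply/subset_leq_card/subsetP => y;
      rewrite !inE => /andP[-> /existsP[x /andP[Ax rxy]]] /=.
    apply/andP; split; apply/existsP; exists x; rewrite ?Ax //.
    by rewrite (subsetP sAA0).
  have le1 : #|D :\: A0| <= n.
    have : 0 < #|A0| by rewrite card_gt0.
    by have := cardsD D A0; rewrite (setIidPr sA0D); lia.
  have hall1 (A : {set X}) : A \subset D :\: A0 ->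
    #|A| <= #|neighbors r (B :\: B0) A|.
    rewrite subsetD => /andP[sAD disA].
    have := hallD (A :|: A0); rewrite subUset sAD sA0D => /(_ isT).
    rewrite cardsU; have -> : A :&: A0 = set0 by apply/eqP; rewrite setI_eq0.
    rewrite cards0 subn0.
    have : #|neighbors r B (A :|: A0)| <= #|neighbors r (B :\: B0) A| + #|B0|.
      rewrite addnC; apply: leq_trans (leq_card_setU _ _);
        apply/subset_leq_card/subsetP => y.
      rewrite !inE => /andP[By /existsP[x /andP[]]]; rewrite By !inE /= => Axx rxy.
      case: (boolP [exists x in A0, r x y]) => //= no0.
      apply/existsP; exists x; rewrite rxy andbT; case/orP: Axx => // A0x.
      by case/existsP: no0; exists x; rewrite A0x.
    by move: tight; rewrite -/B0; lia.
  have [f0 inj0 f0P] := IH A0 le0 B0 hall0.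
  have [f1 inj1 f1P] := IH (D :\: A0) le1 (B :\: B0) hall1.
  exists (fun x => if x \in A0 then f0 x else f1 x) => [x x' Dx Dx'|x Dx].
    have D1 z : z \in D -> z \notin A0 -> z \in D :\: A0 by rewrite inE => -> ->.
    case: ifPn => Ax; case: ifPn => Ax' eqf.
    - exact: inj0.
    - have := f1P x' (D1 _ Dx' Ax'); have := f0P x Ax; rewrite eqf.
      by case/andP=> fB0 _; rewrite inE fB0.
    - have := f1P x (D1 _ Dx Ax); have := f0P x' Ax'; rewrite eqf.
      by case/andP=> fB0 _; rewrite inE fB0.
    by apply: inj1 => //; apply: D1.
  case: ifPn => Ax; first by case/andP: (f0P x Ax); rewrite inE => /andP[-> _] ->.
  by have := f1P x; rewrite !inE Ax Dx => /(_ isT)/andP[/andP[_ ->]].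
rewrite negb_exists => /forallP loose.
have [y1 y1N] : exists y, y \in neighbors r B [set x0].
  apply/set0Pn; rewrite -card_gt0; apply: leq_trans (hallD [set x0] _);
    first by rewrite cards1.
  by rewrite sub1set.
have [By1 rx0] : y1 \in B /\ r x0 y1.
  move: y1N; rewrite inE => /andP[-> /existsP[x /andP[]]]; rewrite inE => /eqP-> //.
have le1 : #|D :\ x0| <= n by rewrite (cardsD1 x0) Dx0 in leDn.
have hall1 (A : {set X}) : A \subset D :\ x0 -> #|A| <= #|neighbors r (B :\ y1) A|.
  rewrite subsetD1 => /andP[sAD x0A]; case: (set_0Vmem A) => [->|[x Ax]];
    first by rewrite cards0.
  have prA : A \proper D.
    by rewrite properE sAD; apply: contra x0A => /subsetP; apply.
  have ntA : A != set0 by apply/set0Pn; exists x.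
  have lt : #|A| < #|neighbors r B A| by have := loose A; rewrite prA ntA /= ltnNge.
  have : #|neighbors r B A| <= #|neighbors r (B :\ y1) A| + 1.
    rewrite -(cards1 y1) addnC; apply: leq_trans (leq_card_setU _ _).
    apply/subset_leq_card/subsetP => y; rewrite !inE => /andP[-> ->].
    by case: eqP.
  by lia.
have [f inj fP] := IH (D :\ x0) le1 (B :\ y1) hall1.
exists (fun x => if x == x0 then y1 else f x) => [x x' Dx Dx'|x Dx].
  have D1 z : z \in D -> z != x0 -> z \in D :\ x0 by rewrite !inE => -> ->.
  case: eqP => [->|/eqP nx]; case: eqP => [->|/eqP nx'] // eqf.
  - by have := fP x' (D1 _ Dx' nx'); rewrite -eqf !inE eqxx.
  - by have := fP x (D1 _ Dx nx); rewrite eqf !inE eqxx.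
  by apply: inj => //; apply: D1.
case: eqP => [->|/eqP nx]; first by rewrite By1 rx0.
by have := fP x; rewrite !inE nx Dx => /(_ isT)/andP[/andP[_ ->]].
Qed.

(** * Rotations *)

Definition o0 : 'I_3 := @Ordinal 3 0 isT.
Definition o1 : 'I_3 := @Ordinal 3 1 isT.
Definition o2 : 'I_3 := @Ordinal 3 2 isT.

Lemma ord3P (i : 'I_3) : [\/ i = o0, i = o1 | i = o2].
Proof.
case: i => [[|[|[|//]]] lti]; [constructor 1 | constructor 2 | constructor 3];
  exact: val_inj.
Qed.

Definition S3 : seq 'S_3 :=
  [:: 1; tperm o1 o2; tperm o0 o1; tperm o0 o2;
      tperm o0 o1 * tperm o0 o2; tperm o0 o2 * tperm o0 o1]%g.

Lemma mem_S3 (s : 'S_3) : s \in S3.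
Proof.
have inj i j : i != j -> s i != s j by apply: contra_neq; apply: perm_inj.
have h01 := inj o0 o1 isT; have h02 := inj o0 o2 isT; have h12 := inj o1 o2 isT.
have ext (t : 'S_3) : s o0 = t o0 -> s o1 = t o1 -> s o2 = t o2 -> s = t.
  by move=> e0 e1 e2; apply/permP => i; case: (ord3P i) => ->.
rewrite !inE; apply/or4P.
case: (ord3P (s o0)) (ord3P (s o1)) (ord3P (s o2)) => e0 [] e1 [] e2;
  move: h01 h02 h12; rewrite e0 e1 e2 // => _ _ _.
- by constructor 1; apply/eqP/ext; rewrite !permE ?e0 ?e1 ?e2.
- by constructor 2; apply/eqP/ext; rewrite !permE ?e0 ?e1 ?e2.
- by constructor 3; apply/eqP/ext; rewrite !permE ?e0 ?e1 ?e2.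
- constructor 4; apply/or3P; constructor 2; apply/eqP/ext;
    rewrite !permE /= ?permE ?e0 ?e1 ?e2 //.
- constructor 4; apply/or3P; constructor 3; apply/eqP/ext;
    rewrite !permE /= ?permE ?e0 ?e1 ?e2 //.
- constructor 4; apply/or3P; constructor 1; apply/eqP/ext;
    rewrite !permE /= ?permE ?e0 ?e1 ?e2 //.
Qed.

Definition axis_maps : seq (seq nat * bool) :=
  [:: ([:: 0; 1; 2], false); ([:: 0; 2; 1], true); ([:: 1; 0; 2], true);
      ([:: 2; 1; 0], true); ([:: 1; 2; 0], false); ([:: 2; 0; 1], false)].

Definition values (s : 'S_3) : seq nat := [:: val (s o0); val (s o1); val (s o2)].

Lemma S3_values : [seq (values s, odd_perm s) | s <- S3] = axis_maps.
Proof.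
by rewrite /= /values !odd_permM !odd_tperm odd_perm1 !permM !perm1 !permE /=
  ?permE.
Qed.

Definition signs : seq (seq bool) :=
  [seq [:: a; bc.1; bc.2] | a <- [:: false; true],
     bc <- [:: (false, false); (false, true); (true, false); (true, true)]].

Definition face_map (s : seq nat) (e : seq bool) : seq nat :=
  flatten [seq [:: 2 * nth 0 s a + nth false e a; 2 * nth 0 s a + ~~ nth false e a]
             | a <- iota 0 3].

Definition rotations : seq (seq nat) :=
  Eval vm_compute in
  [seq face_map sb.1 e | sb <- axis_maps,
    e <- [seq e <- signs | odd (count id e) == sb.2]].

Definition face_index (f : face) : nat := 2 * f.1 + f.2.

Definition faces : seq face :=
  [:: (o0, false); (o0, true); (o1, false); (o1, true); (o2, false); (o2, true)].

Lemma mem_faces f : f \in faces.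
Proof. by case: f => a b; case: (ord3P a) => ->; case: b. Qed.

Lemma face_index_lt f : face_index f < 6.
Proof. by case: f => a b; case: (ord3P a) => ->; case: b. Qed.

Lemma nth_faces f : nth (o0, false) faces (face_index f) = f.
Proof. by case: f => a b; case: (ord3P a) => ->; case: b. Qed.

Lemma face_index_nth g : g < 6 -> face_index (nth (o0, false) faces g) = g.
Proof. by case: g => [|[|[|[|[|[|]]]]]]. Qed.

(** The determinant is the sign of the permutation times one factor -1 for each reversed axis. *)
Lemma det_isometry (r : 'S_3 * {ffun 'I_3 -> bool}) :
  (\det (isometry_mx r) == 1)%R = (odd_perm r.1 == odd (r.2 o0 + r.2 o1 + r.2 o2)).
Proof.
rewrite /isometry_mx det_mulmx det_diag det_perm !big_ord_recl big_ord0 !mxE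
  GRing.mulr1.
have -> : ord0 = o0 by apply: val_inj.
have -> : lift o0 (ord0 : 'I_2) = o1 by apply: val_inj.
have -> : lift o0 (lift ord0 (ord0 : 'I_1)) = o2 by apply: val_inj.
by case: (r.2 o0); case: (r.2 o1); case: (r.2 o2); case: (odd_perm r.1).
Qed.

Definition face_table (r : rotation) : seq nat :=
  [seq face_index (rotate r f) | f <- faces].

Lemma nth_face_table r f : nth 0 (face_table r) (face_index f) =
  face_index (rotate r f).
Proof. by rewrite (nth_map (o0, false)) ?nth_faces ?face_index_lt. Qed.

Lemma face_tableE r :
  face_table r = face_map (values (val r).1) [:: (val r).2 o0; (val r).2 o1;
    (val r).2 o2].
Proof.
rewrite /face_table /rotate /face_index /face_map /=.
by case: ((val r).2 o0); case: ((val r).2 o1); case: ((val r).2 o2).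
Qed.

(** Together with [rotation_of_table] this turns quantification over rotations into a computation
    over 24 tables. *)
Lemma face_table_rotation r : face_table r \in rotations.
Proof.
have := valP r; rewrite face_tableE det_isometry.
case: (val r) => s e /=; have : (values s, odd_perm s) \in axis_maps.
  by rewrite -S3_values; apply: (map_f (fun s => (values s, odd_perm s))); apply:
    mem_S3.
move: (values s) (odd_perm s) => vs b;
  rewrite !inE => /or4P[|||/or3P[]] /eqP[-> ->];
by case: (e o0); case: (e o1); case: (e o2).
Qed.

Lemma rotation_of_table t : t \in rotations -> exists r, face_table r = t.
Proof.
have -> : rotations = [seq face_map sb.1 e | sb <- axis_maps,
  e <- [seq e <- signs | odd (count id e) == sb.2]] by [].
case/allpairsPdep=> -[vs b] [e [sb_in e_in ->]] /=.
have [s [vsE bE]] : exists s, values s = vs /\ odd_perm s = b.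
  by move: sb_in; rewrite -S3_values => /mapP[s _ [-> ->]]; exists s.
have [a0 [a1 [a2 [eE par]]]] :
  exists a0 a1 a2, e = [:: a0; a1; a2] /\ odd (a0 + a1 + a2) = b.
  move: e_in; rewrite mem_filter => /andP[/eqP /= par].
  case/allpairsP=> -[a0 [a1 a2]] [_ _ eE]; exists a0, a1, a2; split=> //.
  by rewrite -par eE {eE}; case: a0; case: a1; case: a2.
pose f := [ffun i : 'I_3 => nth false e i].
have det1 : (\det (isometry_mx (s, f)) == 1)%R.
  by rewrite det_isometry /= !ffunE eE /= par bE.
exists (Sub (s, f) det1); rewrite face_tableE SubK /= !ffunE vsE eE.
by [].
Qed.

Definition coloring_of (q : colored_cube) : seq nat :=
  [seq val (paint q f) | f <- faces].

Lemma nth_coloring_of q f : nth 0 (coloring_of q) (face_index f) = paint q f.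
Proof. by rewrite (nth_map (o0, false)) ?nth_faces ?face_index_lt. Qed.

Lemma coloring_of_coloring q : coloring_of q \in colorings.
Proof.
have sub : {subset iota 0 6 <= coloring_of q}.
  move=> c; rewrite mem_iota add0n => /= ltc.
  have /forallP/(_ (Ordinal ltc))/existsP[f /eqP qf] := valP q.
  by apply/mapP; exists f; rewrite ?mem_faces // /paint qf.
have uq : uniq (coloring_of q).
  by apply: leq_size_uniq sub _; rewrite ?iota_uniq ?size_map.
rewrite mem_colorings perm_sym; apply: uniq_perm => //.
have [_ eqc] : (size (iota 0 6) = size (coloring_of q)) *
  (iota 0 6 =i coloring_of q).
  by apply: uniq_min_size sub _; rewrite ?iota_uniq ?size_map.
exact: eqc.
Qed.

Lemma cube_of_coloring q : q \in colorings -> exists big, coloring_of big = q.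
Proof.
move=> cq; pose p : {ffun face -> color} :=
  [ffun f => inord (nth 0 q (face_index f))].
have pE f : p f = nth 0 q (face_index f) :> nat.
  by rewrite ffunE /= inordK //; apply: coloring_nth_lt cq (face_index_lt f).
have surj : [forall c, [exists f, p f == c]].
  apply/forallP => c; have qc : val c \in q.
    by rewrite (coloring_mem _ cq) [val c < 6]ltn_ord.
  have lti : index (val c) q < 6 by move: qc; rewrite -index_mem (coloring_size cq).
  apply/existsP; exists (nth (o0, false) faces (index (val c) q));
    apply/eqP/val_inj.
  by rewrite [LHS]pE face_index_nth // nth_index.
exists (Sub p surj); apply: (@eq_from_nth _ 0);
  first by rewrite size_map (coloring_size cq).
move=> g; rewrite size_map => ltg; rewrite -(face_index_nth ltg) nth_coloring_of.
by rewrite /paint SubK pE.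
Qed.

(** * Placing one cube on a corner or an edge *)

Definition placeable (p q fs : seq nat) : bool :=
  has (fun t => all (fun g => (nth 0 t g \in fs) ==>
    (nth 0 p g == nth 0 q (nth 0 t g)))
                    (iota 0 6)) rotations.

Definition matches (p q : colored_cube) (n : nat) (x : position n) (r : rotation) :
  bool :=
  [forall g, on_face x (rotate r g) ==> (paint p g == paint q (rotate r g))].

Lemma placeableP p q n (x : position n) fs :
  (forall f, on_face x f = (face_index f \in fs)) ->
  reflect (exists r, matches p q x r)
    (placeable (coloring_of p) (coloring_of q) fs).
Proof.
move=> fsE; apply: (iffP hasP) =>
  [[t /rotation_of_table[r <-] /all_iotaP ok]|[r /forallP ok]].
  exists r; apply/forallP => g; have := ok _ (face_index_lt g).
  by rewrite nth_face_table !nth_coloring_of -fsE.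
exists (face_table r); first exact: face_table_rotation.
apply/all_iotaP => g ltg; have [f ->] : exists f, g = face_index f.
  by exists (nth (o0, false) faces g); rewrite face_index_nth.
by rewrite nth_face_table !nth_coloring_of -fsE; apply: ok.
Qed.

Definition corner (k : nat) : seq nat := nth [::] corner_faces k.

Lemma nth_corner_triples p k : k < 8 ->
  nth [::] (corner_triples p) k = canon3 [seq nth 0 p f | f <- corner k].
Proof. by move=> ltk; rewrite (nth_map [::]). Qed.

Lemma mem_corner_triples p t : t \in corner_triples p ->
  exists2 j, j < 8 & t = canon3 [seq nth 0 p f | f <- corner j].
Proof.
by case/(nthP [::]) => j; rewrite size_map => ltj <-; exists j => //;
  rewrite nth_corner_triples.
Qed.

Lemma canon3E (l : seq nat) : size l = 3 -> exists2 i, i < 3 & canon3 l = rot i l.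
Proof.
case: l => [|a [|b [|c []]]] // _; rewrite /canon3.
by case: ifP => _; [exists 0 | case: ifP => _; [exists 1 | exists 2]].
Qed.

Lemma canon3_rotP (l l' : seq nat) : size l = 3 -> size l' = 3 ->
  canon3 l = canon3 l' ->
  exists2 i, i < 3 & l = rot i l'.
Proof.
move=> sz sz'; have [i lti ->] := canon3E sz; have [i' lti' ->] := canon3E sz'.
case: l l' sz sz' => [|a [|b [|c []]]] // [|x [|y [|z []]]] // _ _.
by case: i i' lti lti' => [|[|[|//]]] [|[|[|//]]] // _ _ [-> -> ->];
  [exists 0 | exists 1 | exists 2 | exists 2 | exists 0 | exists 1 | exists 1 |
    exists 2 | exists 0].
Qed.

Lemma canon3_roti (l : seq nat) i : uniq l -> size l = 3 -> i < 3 ->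
  canon3 (rot i l) = canon3 l.
Proof.
case: l => [|a [|b [|c []]]] // ul _; case: i => [|[|[|//]]] _;
  first by rewrite rot0.
  exact: canon3_rot.
rewrite -[RHS]canon3_rot // -[RHS]canon3_rot //.
by move: ul; rewrite -(rot_uniq 1).
Qed.

Lemma corner_size k : k < 8 -> size (corner k) = 3.
Proof. by case: k => [|[|[|[|[|[|[|[|]]]]]]]]. Qed.

Lemma corner_colors_uniq q k : q \in colorings -> k < 8 ->
  uniq [seq nth 0 q f | f <- corner k].
Proof.
move=> cq ltk; rewrite map_inj_in_uniq; first by case:
  k ltk => [|[|[|[|[|[|[|[|]]]]]]]].
have lt6 : all (gtn 6) (corner k) by case: k ltk => [|[|[|[|[|[|[|[|]]]]]]]].
move=> f g /(allP lt6) ltf /(allP lt6) ltg /eqP.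
by rewrite nth_uniq ?coloring_size ?coloring_uniq // => /eqP.
Qed.

(** A rotation brings some corner to [k] with its cyclic order kept, and conversely every corner can
    be brought to [k] with any cyclic shift. Both facts are checked over all rotations. *)
Lemma placeable_corner p q k : p \in colorings -> q \in colorings -> k < 8 ->
  placeable p q (corner k) = (nth [::] (corner_triples q) k \in corner_triples p).
Proof.
move=> cp cq ltk; rewrite nth_corner_triples //;
  apply/hasP/idP => [[t t_in /allP ok]|].
  have chk : all (fun t => all (fun k => has (fun j => has (fun i =>
      [seq nth 0 t g | g <- corner j] == rot i (corner k)) (iota 0 3)) (iota 0 8))
        (iota 0 8)) rotations.
    by vm_cast_no_check (erefl true).
  move/allP: chk => /(_ t t_in)/all_iotaP/(_ k ltk)/hasP[j];
    rewrite mem_iota => ltj.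
  case/hasP=> i; rewrite mem_iota => lti /eqP tE.
  have -> : canon3 [seq nth 0 q f | f <- corner k] =
    canon3 [seq nth 0 p f | f <- corner j].
    rewrite -(@canon3_roti _ i) ?corner_colors_uniq ?size_map ?corner_size //.
    rewrite -map_rot -tE -map_comp; congr canon3; apply/eq_in_map => g g_in /=.
    have ltg : g \in iota 0 6.
      by move: g g_in; apply/allP; case: j ltj {tE} => [|[|[|[|[|[|[|[|]]]]]]]].
    have : nth 0 t g \in corner k by rewrite -(mem_rot i) -tE map_f.
    by have := ok g ltg => /implyP/[apply]/eqP.
  by rewrite -nth_corner_triples // mem_nth.
case/mem_corner_triples=> j ltj eqc.
have [|||i lti eqr] := @canon3_rotP [seq nth 0 p f | f <- corner j]
  [seq nth 0 q f | f <- corner k].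
- by rewrite size_map corner_size.
- by rewrite size_map corner_size.
- by rewrite eqc.
have chk : all (fun j => all (fun k => all (fun i => has (fun t =>
    ([seq nth 0 t g | g <- corner j] == rot i (corner k))
    && all (fun g => (nth 0 t g \in corner k) ==> (g \in corner j)) (iota 0 6))
      rotations)
    (iota 0 3)) (iota 0 8)) (iota 0 8).
  by vm_cast_no_check (erefl true).
move/all_iotaP: chk => /(_ j ltj)/all_iotaP/(_ k ltk)/all_iotaP/(_ i lti)/hasP[t
  t_in].
case/andP=> /eqP tE /allP inj; exists t => //; apply/allP => g ltg.
apply/implyP => tg; have gj := implyP (inj g ltg) tg.
move: eqr; rewrite -map_rot -tE -map_comp => /eq_in_map/(_ g gj) /= ->.
exact: eqxx.
Qed.

Lemma sort2C a b : sort2 a b = sort2 b a.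
Proof. by rewrite /sort2; case: ltngtP => // ->. Qed.

(** Two colors that are not opposite lie on adjacent faces, and rotations carry each ordered pair of
    adjacent faces to each other one. *)
Lemma placeable_edge p q e : p \in colorings -> q \in colorings ->
  e \in edge_faces ->
  edge_colors q e \notin opposites p -> placeable p q e.
Proof.
move=> cp cq eE nopp.
have [f [g [eq_e ltf ltg neq_fg]]] :
  exists f g, [/\ e = [:: f; g], f < 6, g < 6 & f != g].
  have : all (fun e => if e is [:: f; g] then [&& f < 6, g < 6 & f != g] else false)
    edge_faces by [].
  by move/allP/(_ e eE); case: e {eE nopp} => [|f [|g []]] // /and3P[]; exists f, g.
pose i := index (nth 0 q f) p; pose j := index (nth 0 q g) p.
have pf : nth 0 q f \in p by rewrite (coloring_mem _ cp) coloring_nth_lt.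
have pg : nth 0 q g \in p by rewrite (coloring_mem _ cp) coloring_nth_lt.
have lti : i < 6 by move: pf; rewrite -index_mem (coloring_size cp).
have ltj : j < 6 by move: pg; rewrite -index_mem (coloring_size cp).
have pi : nth 0 p i = nth 0 q f by apply: nth_index.
have pj : nth 0 p j = nth 0 q g by apply: nth_index.
(* Half the index of a face, rounded down, is its axis. *)
have neq_ij : i./2 != j./2.
  apply: contra nopp; rewrite eq_e /edge_colors /= -pi -pj.
  have : i != j.
    by apply: contra neq_fg => /eqP eq_ij; move: pj; rewrite -eq_ij pi => /eqP;
      rewrite nth_uniq ?coloring_size ?coloring_uniq.
  rewrite !inE /=; move: (i) (j) lti ltj =>
    [|[|[|[|[|[|//]]]]]] [|[|[|[|[|[|//]]]]]] //= _ _ _ _;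
    by rewrite ?eqxx ?orbT // sort2C ?eqxx ?orbT.
have chk : all (fun e => all (fun i => all (fun j => (i./2 == j./2) || has (fun t =>
    ([seq nth 0 t g | g <- [:: i; j]] == e)
    && all (fun g => (nth 0 t g \in e) ==> (g \in [:: i; j])) (iota 0 6)) rotations)
    (iota 0 6)) (iota 0 6)) edge_faces.
  by vm_cast_no_check (erefl true).
move/allP: chk => /(_ e eE)/all_iotaP/(_ i lti)/all_iotaP/(_ j ltj).
rewrite (negPf neq_ij) => /hasP[t t_in /andP[/eqP tE /allP inj]].
apply/hasP; exists t => //; apply/allP => h lth; apply/implyP => th.
have := implyP (inj h lth) th; move: tE; rewrite eq_e => -[tf tg].
by rewrite !inE => /orP[]/eqP->; rewrite ?tf ?tg ?pi ?pj.
Qed.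

(** * Frames *)

Definition coordinate (fs : seq nat) (a : nat) : nat :=
  if 2 * a \in fs then 0 else if (2 * a).+1 \in fs then 2 else 1.

Definition pos_of (fs : seq nat) : position 3 :=
  [ffun a : 'I_3 => inord (coordinate fs a)].

Lemma pos_ofE fs a : pos_of fs a = coordinate fs a :> nat.
Proof. by rewrite ffunE inordK // /coordinate; do 2?case: ifP. Qed.

Lemma on_face_pos_of fs f : fs \in corner_faces ++ edge_faces ->
  on_face (pos_of fs) f = (face_index f \in fs).
Proof.
move=> fs_in; have : all (fun fs =>
  all (fun a => (coordinate fs a == 0) == (2 * a \in fs)) (iota 0 3)
   && all (fun a => (coordinate fs a == 2) == ((2 * a).+1 \in fs)) (iota 0 3))
     (corner_faces ++ edge_faces) by [].
move/allP/(_ fs fs_in)/andP => [/all_iotaP ok0 /all_iotaP ok1].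
case: f => a [] /=; rewrite /on_face pos_ofE /face_index /=.
  by rewrite addn1; have /eqP := ok1 _ (ltn_ord a).
by rewrite addn0; have /eqP := ok0 _ (ltn_ord a).
Qed.

Lemma frame_pos_of x : x \in frame 3 ->
  exists2 fs, fs \in corner_faces ++ edge_faces & x = pos_of fs.
Proof.
rewrite inE => /existsP[f /existsP[g /and3P[neq_fg xf xg]]].
have off (h : face) : on_face x h -> x h.1 != 1 :> nat by move/eqP->; case: h.2.
have chk : all (fun t0 => all (fun t1 => all (fun t2 =>
     (count_mem 1 [:: t0; t1; t2] <= 1) ==>
     has (fun fs => [&& coordinate fs 0 == t0, coordinate fs 1 == t1 &
       coordinate fs 2 == t2])
         (corner_faces ++ edge_faces)) (iota 0 3)) (iota 0 3)) (iota 0 3) by [].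
(* The two non-parallel faces through [x] fix two coordinates at 0 or 2, so the middle value 1
   occurs at most once. *)
have le1 : count_mem 1 [:: x o0 : nat; x o1 : nat; x o2 : nat] <= 1.
  move: neq_fg (off f xf) (off g xg).
  by case: (ord3P f.1) => ->; case: (ord3P g.1) => -> //= _ /negPf-> /negPf->;
     rewrite ?addn0 ?add0n ?leq_b1.
move/all_iotaP: chk => /(_ _ (ltn_ord (x o0)))/all_iotaP/(_ _
  (ltn_ord (x o1)))/all_iotaP.
move=> /(_ _ (ltn_ord (x o2)))/implyP/(_ le1)/hasP[fs fs_in
  /and3P[/eqP e0 /eqP e1 /eqP e2]].
exists fs => //.
apply/ffunP => a; apply: val_inj; rewrite [RHS]pos_ofE.
by case: (ord3P a) => ->; rewrite /= ?e0 ?e1 ?e2.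
Qed.

Definition filled (A : {set position 3}) : pred (seq nat) :=
  fun fs => pos_of fs \in A.

Lemma card_frame_subset (A : {set position 3}) : A \subset frame 3 ->
  #|A| <= size [seq k <- iota 0 8 | filled A (corner k)] + size
    [seq e <- edge_faces | filled A e].
Proof.
move=> sA; have -> : size [seq k <- iota 0 8 | filled A (corner k)] =
  size [seq fs <- corner_faces | filled A fs].
  by rewrite !size_filter -[corner_faces in RHS]/(map corner (iota 0 8)) count_map.
rewrite -size_cat -filter_cat -(size_map pos_of) cardE.
apply: uniq_leq_size; first exact: enum_uniq.
move=> x; rewrite mem_enum => Ax; have [fs fs_in xE] :=
  frame_pos_of (subsetP sA x Ax).
by rewrite xE map_f // mem_filter fs_in andbT /filled -xE.
Qed.

(** The sum in [good] runs over representatives of the varieties, while Hall's theorem needs the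
    actual cubes, which are turned copies of them. *)
Lemma variety_fits p q C E : p \in colorings -> corner_set C ->
  fits (variety (variety_of p)) q C E -> fits p q C E.
Proof.
pose ok p := all [in opp (variety_of p)] (opposites p).
have chk : all ok colorings by vm_cast_no_check (erefl true).
move=> cp sC; have [ltv eqc] := variety_ofP cp.
have sub : {subset opposites p <= opp (variety_of p)}.
  by apply/allP; apply: (allP chk).
case/orP=> [/hasP[k Ck hit]|/hasP[e Ee no]].
  by apply/orP; left; apply/hasP; exists k; rewrite -?eqc.
apply/orP; right; apply/hasP; exists e; first exact: Ee.
by apply: contra no => /sub; rewrite oppE.
Qed.

Lemma sum_fibers (I : finType) (v : I -> nat) (P : pred nat) n :
  (forall i, v i < n) ->
  \sum_(0 <= V < n | P V) #|[set i | v i == V]| = #|[set i | P (v i)]|.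
Proof.
move=> ltv; under eq_bigr do rewrite -sum1_card.
under eq_bigr do (under eq_bigl do rewrite inE; rewrite big_mkcond).
rewrite exchange_big /= -sum1_card [RHS]big_mkcond; apply: eq_bigr => i _.
rewrite inE big_mkcond (bigD1_seq (v i)) ?mem_index_iota ?iota_uniq //= eqxx.
by rewrite big1 ?addn0 // => V; rewrite eq_sym => /negPf->; case: ifP.
Qed.

Theorem frame_24 : frame_always_buildable 3 24.
Proof.
move=> c; pose v i := variety_of (coloring_of (c i)).
have cc i : coloring_of (c i) \in colorings := coloring_of_coloring (c i).
have ltv i : v i < 30 by case: (variety_ofP (cc i)).
pose m V := #|[set i | v i == V]|.
have sum_m : \sum_(0 <= V < 30) m V = 24.
  by rewrite (sum_fibers predT ltv) cardsE card_ord.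
have [q cq gq] := selection sum_m; have [big bigE] := cube_of_coloring cq.
pose r (x : position 3) i := [exists s, matches (c i) big x s].
have rP fs i : fs \in corner_faces ++ edge_faces ->
  placeable (coloring_of (c i)) q fs -> r (pos_of fs) i.
  move=> fs_in; rewrite -bigE => pl; apply/existsP.
  by apply/placeableP: pl => f; apply: on_face_pos_of.
have hall (A : {set position 3}) : A \subset frame 3 ->
  #|A| <= #|neighbors r setT A|.
  move=> sA; apply: leq_trans (card_frame_subset sA) _.
  set C := [seq k <- _ | _]; set E := [seq e <- _ | _].
  have sC : corner_set C.
    rewrite /corner_set filter_uniq ?iota_uniq //=; apply/allP => k.
    by rewrite mem_filter mem_iota => /andP[].
  have sE : edge_set E.
    rewrite /edge_set filter_uniq //=; apply/allP => e;
      by rewrite mem_filter => /andP[].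
  apply: leq_trans (gq C E sC sE) _; rewrite sum_fibers //.
  apply/subset_leq_card/subsetP => i; rewrite !inE => /(variety_fits (cc i) sC).
  case/orP=> [/hasP[k]|/hasP[e]].
    rewrite mem_filter mem_iota => /andP[Ak ltk] hit.
    apply/existsP; exists (pos_of (corner k)); apply/andP; split; first exact: Ak.
    apply: rP.
      by rewrite mem_cat mem_nth.
    by rewrite placeable_corner.
  rewrite mem_filter => /andP[Ae eE] no; apply/existsP; exists (pos_of e).
  apply/andP; split; [exact: Ae | apply: rP].
    by rewrite mem_cat eE orbT.
  exact: placeable_edge.
have [sel inj selP] := hall_within ord0 hall.
have [rot rotP] : exists rot, forall x, x \in frame 3 ->
  matches (c (sel x)) big x (rot x).
  (* The identity is the default where no rotation matches, which never happens on the frame. *)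
  have [r0 _] : exists r0, face_table r0 = iota 0 6 by apply: rotation_of_table.
  exists (fun x => odflt r0 [pick s | matches (c (sel x)) big x s]) =>
    x /selP /andP[_ /existsP[s ms]].
  by case: pickP => //= /(_ s); rewrite ms.
exists big, sel, rot; split=> // x g /rotP/forallP/(_ g)/implyP ok /ok/eqP.
by [].
Qed.

(** * Twenty-three cubes do not suffice *)

Definition cube_of (q : seq nat) (c0 : colored_cube) : colored_cube :=
  odflt c0 [pick c | coloring_of c == q].

Lemma cube_ofK q c0 : q \in colorings -> coloring_of (cube_of q c0) = q.
Proof.
move=> /cube_of_coloring[c cE]; rewrite /cube_of; case:
  pickP => [c' /eqP //|/(_ c)].
by rewrite cE eqxx.
Qed.

Lemma corner_pos_frame k : k < 8 -> pos_of (corner k) \in frame 3.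
Proof.
move=> ltk; have k_in : corner k \in corner_faces ++ edge_faces
  by rewrite mem_cat mem_nth.
rewrite inE; apply/existsP; exists (nth (o0, false) faces (nth 0 (corner k) 0)).
apply/existsP; exists (nth (o0, false) faces (nth 0 (corner k) 1)).
rewrite !on_face_pos_of //; by case: k ltk {k_in} => [|[|[|[|[|[|[|[|]]]]]]]].
Qed.

Lemma corner_pos_inj k j : k < 8 -> j < 8 ->
  pos_of (corner k) = pos_of (corner j) -> k = j.
Proof.
have chk : all (fun k => all (fun j =>
   all (fun a => coordinate (corner k) a == coordinate (corner j) a) (iota 0 3) ==>
     (k == j)) (iota 0 8)) (iota 0 8).
  by vm_cast_no_check (erefl true).
move=> ltk ltj eqp; apply/eqP; move/all_iotaP:
  chk => /(_ k ltk)/all_iotaP/(_ j ltj)/implyP; apply.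
apply/all_iotaP => a lta; rewrite -[a]/(val (Ordinal lta)) -!pos_ofE eqp.
exact: eqxx.
Qed.

(* Varieties 0, 11, 15, 20 and 26 pairwise share no corner. *)
Definition extremal : seq nat := nseq 7 0 ++ nseq 7 11 ++ nseq 7 15 ++ [:: 20; 26].

(* Hall's condition fails for all corners if the big cube has one of the five
   varieties, and otherwise for the corners that none of the three frequent
   varieties has. *)
Definition violators (q : seq nat) : seq (seq nat) :=
  [:: iota 0 8;
      [seq k <- iota 0 8 | ~~ has (fun V => nth [::] (corner_triples q) k
                                            \in nth [::] variety_corners V) [:: 0;
                                              11; 15]]].

Definition violated (q : seq nat) : bool :=
  has (fun C => count (fun V => has (fun k => nth [::] (corner_triples q) k
                                   \in nth [::] variety_corners V) C) extremal <
                                     size C)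
      (violators q).

Lemma extremal_violated : all violated colorings.
Proof. vm_cast_no_check (erefl true). Qed.

Lemma violators_corner_set q C : C \in violators q -> corner_set C.
Proof.
rewrite !inE => /orP[]/eqP-> //; apply/andP; split;
  first by rewrite filter_uniq ?iota_uniq.
by apply/allP => k; rewrite mem_filter mem_iota => /andP[].
Qed.

Theorem frame_ge24 M : frame_always_buildable 3 M -> 24 <= M.
Proof.
move=> build; rewrite leqNgt; apply/negP => ltM.
have [c0 _] : exists c0, coloring_of c0 = variety 0
  by apply/cube_of_coloring/variety_coloring.
(* For [M] below 23 the counterexample is the initial segment of [extremal] of length [M]. *)
pose w i := nth 0 extremal i.
have ltw i : w i < 30.
  case: (ltnP i 23) => [lti|le]; last by rewrite /w nth_default.
  by move: i lti; apply/all_iotaP.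
have [big [sel [rot [inj ok]]]] :=
  build (fun i : 'I_M => cube_of (variety (w i)) c0).
pose q := coloring_of big; have cq : q \in colorings := coloring_of_coloring big.
have /hasP[C C_in ltC] := allP extremal_violated q cq.
have /andP[uC /allP ltC8] := violators_corner_set C_in.
pose i k := sel (pos_of (corner k)).
have hit k : k \in C -> nth [::] (corner_triples q) k \in corner_triples
  (variety (w (i k))).
  move=> kC; have ltk : k < 8 := ltC8 k kC.
  have k_in : corner k \in corner_faces ++ edge_faces by rewrite mem_cat mem_nth.
  have cw : variety (w (i k)) \in colorings by apply: variety_coloring.
  rewrite -placeable_corner // -(cube_ofK c0 cw).
  apply/(placeableP _ _ (x := pos_of (corner k))) => [f|]; first exact:
    on_face_pos_of.
  exists (rot (pos_of (corner k))); apply/forallP => g; apply/implyP => on_g.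
  by apply/eqP; apply: ok on_g; apply: corner_pos_frame.
(* A completed frame uses distinct cubes at the corners in [C], each having the required corner, so
   [extremal] would contain [size C] such entries. *)
have ui : uniq [seq val (i k) | k <- C].
  rewrite map_inj_in_uniq // => k j kC jC /val_inj eq_ij.
  apply: corner_pos_inj (ltC8 _ kC) (ltC8 _ jC) _.
  by apply: inj eq_ij; apply: corner_pos_frame; apply: ltC8.
suff : size C <= count (fun V => has (fun k => nth [::] (corner_triples q) k
                                   \in nth [::] variety_corners V) C) extremal.
  by rewrite leqNgt ltC.
pose P V := has (fun k => nth [::] (corner_triples q) k \in nth [::] variety_corners
  V) C.
have -> : count P extremal = count (P \o w) (iota 0 23).
  by rewrite -count_map map_nth_iota0.
rewrite -size_filter -[leqLHS](size_map (fun k => val (i k))); apply: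
  uniq_leq_size => // n.
case/mapP=> k kC ->; rewrite mem_filter mem_iota; apply/andP; split; last first.
  by apply: leq_trans (ltn_ord (i k)) _.
by apply/hasP; exists k => //; rewrite variety_cornersE ltw hit.
Qed.

Theorem theoremA : frame_always_buildable 3 24 /\ is_fr 3 24.
Proof. by split; [|split];
  [exact: frame_24 | exact: frame_24 | exact: frame_ge24]. Qed.
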